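(* Let $s>\frac12$ (the capacity parameter of the kernel), $r\ge\frac12$, $Q>0$, and let $\{l_n\}$ be a sequence of positive integers with $l_n=o\left(n^{\frac1{2s(2r+1)}}\right)$. Let $G(l_n)$ be the collection of all $l_n$-sized estimators. Then $$\lim_{n\to\infty}\ \inf_{G_n\in G(l_n)}\ \sup_{f^*\in\mathcal W\cap\mathcal W^r(\mathbb S^{d-1})}\mathbb E\left[n^{\frac{2r}{2r+1}}\left\|G_n\left(\{(X_i,Y_i)\}_{1\le i\le n}\right)-f^*\right\|_\omega^2\right]=\infty .$$
   Context: $d\ge2$; $\omega$ is the surface measure on $\mathbb S^{d-1}$, $\Omega_{d-1}=\omega(\mathbb S^{d-1})$, $\|f\|_\omega^2=\frac1{\Omega_{d-1}}\int_{\mathbb S^{d-1}}f^2d\omega$. $\mathcal H_k^d$ is the space of spherical harmonics of degree $k$ on $\mathbb S^{d-1}$, $\{Y_{k,j}\}_{1\le j\le\dim\mathcal H_k^d}$ an orthonormal basis of it for the inner product inducing $\|\cdot\|_\omega$, $\Pi_k^d$ the space of restrictions to $\mathbb S^{d-1}$ of polynomials of degree at most $k$. Coefficients $0<a_k\le1$ satisfy $\lim_{k\to\infty}a_k(\dim\Pi_k^d)^{2s}\in(0,\infty)$. $\mathcal H_K=\{f=\sum_{k,j}f_{k,j}Y_{k,j}:\|f\|_K^2=\sum_{k,j}f_{k,j}^2/a_k<\infty\}$ is the RKHS of $K(x,x')=\sum_ka_k\sum_jY_{k,j}(x)Y_{k,j}(x')$, $\mathcal W=\{f\in\mathcal H_K:\|f\|_K\le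 Q\}$, and $\mathcal W^r(\mathbb S^{d-1})=\{f=\sum_{k,j}f_{k,j}Y_{k,j}:\sum_{k,j}f_{k,j}^2/a_k^{2r}<\infty\}$. Samples $(X_i,Y_i)$ take values in $\Omega\times\mathcal Y$ ($\Omega$ the input space, $\mathcal Y$ the output set). For each target $f^*$ the samples $(X_i,Y_i)_{1\le i\le n}$ are i.i.d. from a data distribution $\rho=\rho_{f^*}$ associated with $f^*$ (the assignment $f^*\mapsto\rho_{f^*}$ is fixed); $\mathbb E$ is over the samples and any randomization of the encoder. For $l_n\in\mathbb N_+$, an $l_n$-sized estimator is a composition $G_n=D_n\circ E_n:(\Omega\times\mathcal Y)^n\to\mathcal W$, where the encoder $E_n:(\Omega\times\mathcal Y)^n\to\{0,1\}^{l_n}$ may be randomized or deterministic, and the decoder $D_n:\{0,1\}^{l_n}\to\mathcal W$ is a known deterministic map. *)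

(* Defs.v *)
From HB Require Import structures.
From mathcomp Require Import all_boot all_order all_algebra.
From mathcomp Require Import all_classical all_reals all_analysis.
From mathcomp Require Import measurable_realfun.
From mathcomp Require mpoly.
(* mpoly clashes with MathComp-Analysis on several notations and names *)
Import (canonicals, coercions) mpoly.

Set Implicit Arguments.
Unset Strict Implicit.
Unset Printing Implicit Defensive.

Import Order.TTheory GRing.Theory Num.Theory.
Import numFieldNormedType.Exports.

Local Open Scope classical_set_scope.
Local Open Scope ring_scope.

Section tuple_measure.
Context d (T : measurableType d) (R : realType).

(* the product measure mu x ... x mu on n-tuples *)
Fixpoint tuple_measure (mu : set T -> \bar R) (n : nat) :
    set (n.-tuple T) -> \bar R :=
  match n with
  | 0 => dirac [tuple]
  | m.+1 => pushforward (mu \x @tuple_measure mu m)%E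
              (fun p : T * m.-tuple T => [tuple of p.1 :: p.2])
  end.

Let cons_tup m (p : (T * m.-tuple T)%type) : m.+1.-tuple T :=
  [tuple of p.1 :: p.2].

Let measurable_cons_tup m : measurable_fun setT (@cons_tup m).
Proof. by apply: measurable_cons. Qed.

Let is_measure n (nu : set (n.-tuple T) -> \bar R) :=
  [/\ nu set0 = 0%E, forall A, (0 <= nu A)%E, semi_sigma_additive nu &
      sigma_finite setT nu].

Section pack.
Variables (n : nat) (nu : set (n.-tuple T) -> \bar R).
Hypotheses (nu0 : nu set0 = 0%E) (nu_ge0 : forall A, (0 <= nu A)%E).
Hypotheses (nu_sigma : semi_sigma_additive nu) (nu_fin : sigma_finite setT nu).

Definition tuple_measure_packed := nu.
HB.instance Definition _ := isMeasure.Build _ _ _ tuple_measure_packed nu0 nu_ge0 nu_sigma.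
HB.instance Definition _ := Measure_isSigmaFinite.Build _ _ _ tuple_measure_packed nu_fin.
Definition tuple_measure_pack : {sigma_finite_measure set (n.-tuple T) -> \bar R} :=
  tuple_measure_packed.
End pack.

Section step.
Variable mu : {sigma_finite_measure set T -> \bar R}.
Variables (m : nat) (nu : {sigma_finite_measure set (m.-tuple T) -> \bar R}).

Lemma tuple_measure_step_subproof : is_measure (pushforward (mu \x nu)%E (@cons_tup m)).
Proof.
have mc A : measurable A -> measurable (@cons_tup m @^-1` A).
  by move=> mA; rewrite -[X in measurable X]setTI; exact: measurable_cons_tup.
split.
- by rewrite /pushforward preimage_set0 measure0.
- by move=> A; rewrite /pushforward; exact: measure_ge0.
- move=> F mF tF mUF; rewrite /pushforward preimage_bigcup.
  apply: measure_semi_sigma_additive.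
  + by move=> n; exact: mc.
  + apply/trivIsetP => /= i j _ _ ij; rewrite -preimage_setI.
    by move/trivIsetP : tF => /(_ _ _ _ _ ij) ->//; rewrite preimage_set0.
  + by rewrite -preimage_bigcup; exact: mc.
- have [F UF mF] : sigma_finite setT (mu \x nu)%E.
    have /sigma_finiteP[F [TF ndF Foo]] := sigma_finiteT mu.
    have /sigma_finiteP[G [TG ndG Goo]] := sigma_finiteT nu.
    exists (fun n => F n `*` G n).
      rewrite -setXTT TF TG predeqE => -[x y]; split.
        move=> [/= [n _ Fnx] [k _ Gky]]; exists (maxn n k) => //; split.
        - by move: x Fnx; exact/subsetPset/ndF/leq_maxl.
        - by move: y Gky; exact/subsetPset/ndG/leq_maxr.
      by move=> [n _ []/= ? ?]; split; exists n.
    move=> k; have [? ?] := Foo k; have [? ?] := Goo k.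
    split; first exact: measurableX.
    by rewrite product_measure1E// lte_mul_pinfty// ge0_fin_numE.
  pose uncons (t : m.+1.-tuple T) : (T * m.-tuple T)%type :=
    (thead t, [tuple of behead t]).
  have consK : cancel (@cons_tup m) uncons.
    by move=> [x t]; rewrite /uncons/cons_tup theadE; congr pair; exact/val_inj.
  have unconsK : cancel uncons (@cons_tup m).
    by move=> t; rewrite [RHS]tuple_eta; exact/val_inj.
  have muncons : measurable_fun setT uncons.
    apply/measurable_fun_pairP; split.
      exact: measurable_tnth.
    exact: measurable_behead.
  exists (fun i => uncons @^-1` F i).
    by rewrite -preimage_bigcup -UF preimage_setT.
  move=> i; split.
    rewrite -[X in measurable X]setTI; apply: muncons => //.
    exact: (mF i).1.
  rewrite /pushforward -comp_preimage.
  rewrite (_ : uncons \o _ = id); last by apply/funext => p; exact: consK.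
  by rewrite preimage_id; exact: (mF i).2.
Qed.
End step.

Variable mu : {sigma_finite_measure set T -> \bar R}.

Let tuple_measureP n : is_measure (@tuple_measure mu n).
Proof.
elim: n => [|m [nu0 nu_ge0 nu_sigma nu_fin]].
  pose nu : {finite_measure set (0.-tuple T) -> \bar R} := dirac [tuple].
  change (is_measure (nu : set _ -> \bar R)); split.
  - exact: measure0.
  - exact: measure_ge0.
  - exact: measure_semi_sigma_additive.
  - exact: sigma_finiteT.
exact: (tuple_measure_step_subproof mu (tuple_measure_pack nu0 nu_ge0 nu_sigma nu_fin)).
Qed.

Let tuple_measure0 n : @tuple_measure mu n set0 = 0%E.
Proof. by have [] := tuple_measureP n. Qed.

Let tuple_measure_ge0 n A : (0 <= @tuple_measure mu n A)%E.
Proof. by have [] := tuple_measureP n. Qed.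

Let tuple_measure_semi_sigma_additive n :
  semi_sigma_additive (@tuple_measure mu n).
Proof. by have [] := tuple_measureP n. Qed.

HB.instance Definition _ n := isMeasure.Build _ _ _ (@tuple_measure mu n)
  (tuple_measure0 n) (@tuple_measure_ge0 n)
  (@tuple_measure_semi_sigma_additive n).

Let tuple_measure_sigma_finite n : sigma_finite setT (@tuple_measure mu n).
Proof. by have [] := tuple_measureP n. Qed.

HB.instance Definition _ n := Measure_isSigmaFinite.Build _ _ _
  (@tuple_measure mu n) (@tuple_measure_sigma_finite n).

End tuple_measure.

Section iid_sample.
Context d (T : measurableType d) (R : realType).
Variable P : probability T R.

Let tuple_measure_setT n : @tuple_measure _ T R P n setT = 1%E.
Proof.
elim: n => [|n IH]; first exact: diracT.
rewrite /= /pushforward preimage_setT -setXTT.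
by rewrite product_measure1E// [X in (X * _)%E]probability_setT mul1e.
Qed.

HB.instance Definition _ n := Measure_isProbability.Build _ _ _
  (@tuple_measure _ T R P n) (@tuple_measure_setT n).

End iid_sample.

(* the unit sphere S^m of R^(m+1) *)
Definition sphere (R : realType) (m : nat) : Type :=
  {x : m.+1.-tuple R | \sum_(i < m.+1) tnth x i ^+ 2 == 1}.

Section sphere_measurable.
Variables (R : realType) (m : nat).

Lemma sphere_pole_subproof : \sum_(i < m.+1)
  tnth [tuple of (1 : R) :: nseq m 0] i ^+ 2 == 1.
Proof.
rewrite big_ord_recl big1 ?addr0 ?expr1n// => i _.
by rewrite tnthS (tnth_nth 0)/= nth_nseq ltn_ord expr0n.
Qed.

Definition sphere_pole : sphere R m :=
  exist _ [tuple of (1 : R) :: nseq m 0] sphere_pole_subproof.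

HB.instance Definition _ := Choice.copy (sphere R m)
  {x : m.+1.-tuple R | \sum_(i < m.+1) tnth x i ^+ 2 == 1}.
HB.instance Definition _ := isPointed.Build (sphere R m) sphere_pole.

Definition sphere_measurable : set (set (sphere R m)) :=
  preimage_set_system setT (fun x : sphere R m => sval x) measurable.

Let sphere_sigma : sigma_algebra setT sphere_measurable.
Proof.
by apply: sigma_algebra_preimage; exact: sigma_algebra_measurable.
Qed.

Let sphere_measurable0 : sphere_measurable set0.
Proof. by case: sphere_sigma. Qed.

Let sphere_measurableC A : sphere_measurable A -> sphere_measurable (~` A).
Proof. by case: sphere_sigma => _ + _ mA => /(_ A mA); rewrite setTD. Qed.

Let sphere_measurable_bigcup (F : (set (sphere R m))^nat) :
  (forall i, sphere_measurable (F i)) -> sphere_measurable (\bigcup_i F i).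
Proof. by case: sphere_sigma => _ _; exact. Qed.

HB.instance Definition _ := isMeasurable.Build default_measure_display
  (sphere R m) sphere_measurable0 sphere_measurableC sphere_measurable_bigcup.

End sphere_measurable.

Section surface_measure.
Variables (R : realType) (m : nat).

Definition cone (A : set (sphere R m)) : set (m.+1.-tuple R) :=
  [set x | exists2 y, A y &
    exists2 t, 0 < t <= 1 & forall i, tnth x i = t * tnth (sval y) i].

(* the cone-measure form of the surface measure: polar coordinates give
   |surface A| = (m+1) * Leb {t y | y in A, 0 < t <= 1} *)
Definition surface (A : set (sphere R m)) : \bar R :=
  (m.+1%:R%:E * tuple_measure (@lebesgue_measure R) (cone A))%E.

Let sqn (x : m.+1.-tuple R) : R := \sum_(i < m.+1) tnth x i ^+ 2.

Let normalize (x : m.+1.-tuple R) : m.+1.-tuple R :=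
  [tuple (sqn x `^ (1/2))^-1 * tnth x i | i < m.+1].

Let measurable_sqn : measurable_fun setT sqn.
Proof.
apply: measurable_sum => i; apply: measurable_funX.
exact: measurable_tnth.
Qed.

Let measurable_normalize : measurable_fun setT normalize.
Proof.
apply/measurable_fun_tnthP => i.
rewrite (_ : _ \o _ = (fun x => sqn x `^ (- (1/2)) * tnth x i)); last first.
  by apply/funext => x; rewrite /= tnth_mktuple powRN.
apply: measurable_funM; last exact: measurable_tnth.
exact: (measurableT_comp (measurable_powR _) measurable_sqn).
Qed.

Let sqn_sphere (y : sphere R m) : sqn (sval y) = 1.
Proof. by apply/eqP; exact: svalP y. Qed.

Let sqn_scale (t : R) (x z : m.+1.-tuple R) :
  (forall i, tnth x i = t * tnth z i) -> sqn x = t ^+ 2 * sqn z.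
Proof.
by move=> xz; rewrite /sqn mulr_sumr; apply: eq_bigr => i _; rewrite xz exprMn.
Qed.

Let sqrt_powR (t : R) : 0 <= t -> (t ^+ 2) `^ (1/2) = t.
Proof.
by move=> t0; rewrite div1r powR12_sqrt ?sqr_ge0// sqrtr_sqr ger0_norm.
Qed.

Let coneE (B : set (m.+1.-tuple R)) : cone ((fun y => sval y) @^-1` B) =
  (sqn @^-1` `]0, 1]) `&` (normalize @^-1` B).
Proof.
apply/seteqP; split => [x [y By [t /andP[t0 t1] xt]]|x []/=].
  have sx : sqn x = t ^+ 2 by rewrite (sqn_scale xt) sqn_sphere mulr1.
  split; rewrite /= ?in_itv/=.
    by rewrite sx exprn_gt0//= expr_le1// ltW.
  rewrite (_ : normalize x = sval y)//; apply/eq_from_tnth => i.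
  by rewrite tnth_mktuple sx sqrt_powR ?ltW// xt mulKf// gt_eqF.
rewrite in_itv/= => /andP[s0 s1] Bx.
pose t := sqn x `^ (1/2).
have t0 : 0 < t by rewrite powR_gt0.
have tt : t ^+ 2 = sqn x.
  by rewrite /t div1r powR12_sqrt ?ltW// sqr_sqrtr ?ltW.
have nx : forall i, tnth x i = t * tnth (normalize x) i.
  by move=> i; rewrite tnth_mktuple mulVKf// gt_eqF.
have yP : sqn (normalize x) == 1.
  move: (sqn_scale nx); rewrite tt => /esym/eqP.
  by rewrite -[eqbRHS]mulr1 => /eqP/mulfI -/(_ (lt0r_neq0 s0)) ->.
exists (exist _ (normalize x) yP) => //=; exists t => //.
have t1 : t <= 1 by rewrite -(@expr_le1 R 2 t (isT : (0 < 2)%N) (ltW t0)) tt.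
by rewrite t0 t1.
Qed.

Let measurable_cone A : measurable A -> measurable (cone A).
Proof.
move=> [B mB <-]; rewrite setTI coneE; apply: measurableI.
  by rewrite -[X in measurable X]setTI; exact: measurable_sqn.
by rewrite -[X in measurable X]setTI; exact: measurable_normalize.
Qed.

Let cone_inj (A B : set (sphere R m)) x : cone A x -> cone B x ->
  (A `&` B) !=set0.
Proof.
move=> [y Ay [t /andP[t0 _] xt]] [z Bz [u /andP[u0 _] xu]].
have tu : t = u.
  apply/eqP; rewrite -(@eqrXn2 _ 2) ?ltW//; apply/eqP.
  by rewrite -[LHS]mulr1 -(sqn_sphere y) -(sqn_scale xt) (sqn_scale xu)
    sqn_sphere mulr1.
exists y; split => //; rewrite (_ : y = z)//.
apply/val_inj/eq_from_tnth => i; apply: (@mulfI _ t); first by rewrite gt_eqF.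
by rewrite -xt xu tu.
Qed.

Let cone_bigcup (F : (set (sphere R m))^nat) :
  cone (\bigcup_n F n) = \bigcup_n cone (F n).
Proof.
apply/seteqP; split => [x [y [n _ Fny] xy]|x [n _ [y Fny xy]]].
  by exists n => //; exists y.
by exists y => //; exists n.
Qed.

Let surface0 : surface set0 = 0%E.
Proof.
rewrite /surface (_ : cone set0 = set0) ?measure0 ?mule0//.
by rewrite -subset0 => x [].
Qed.

Let surface_ge0 A : (0 <= surface A)%E.
Proof. by apply: mule_ge0; [rewrite lee_fin|exact: measure_ge0]. Qed.

Let surface_sigma_additive : semi_sigma_additive surface.
Proof.
move=> F mF tF mUF; rewrite /surface cone_bigcup.
apply: (@measure_semi_sigma_additive _ _ _ (mscale (m.+1%:R)%:nng
  (tuple_measure (@lebesgue_measure R) (n := m.+1)))).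
- by move=> n; exact: measurable_cone.
- apply/trivIsetP => i j _ _ ij; rewrite -subset0 => x [Fi Fj].
  have [y Fy] := cone_inj Fi Fj.
  by move/trivIsetP : tF => /(_ i j Logic.I Logic.I ij) F0; rewrite F0 in Fy.
- by rewrite -cone_bigcup; exact: measurable_cone.
Qed.

HB.instance Definition _ := isMeasure.Build _ _ _ surface
  surface0 surface_ge0 surface_sigma_additive.

End surface_measure.

Section function_space.
Variables (R : realType) (T : Type).

Definition is_basis (V : set (T -> R)) (N : nat) (b : 'I_N -> T -> R) :=
  [/\ forall i, V (b i),
      forall c : 'I_N -> R, (forall x, \sum_(i < N) c i * b i x = 0) ->
        forall i, c i = 0 &
      forall f, V f -> exists c : 'I_N -> R, forall x,
        f x = \sum_(i < N) c i * b i x].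

(* 0 by convention when V has no finite basis *)
Definition dimf (V : set (T -> R)) : nat :=
  xget 0%N [set N | exists b : 'I_N -> T -> R, is_basis V b].

End function_space.

Section spherical_harmonics.
Variables (R : realType) (m : nat).
Implicit Types (p : mpoly.mpoly m.+1 R) (f g : sphere R m -> R).

Definition sphere_poly p : sphere R m -> R :=
  fun x => mpoly.meval (tnth (sval x)) p.

Definition laplacian p : mpoly.mpoly m.+1 R :=
  \sum_(i < m.+1) mpoly.mderiv i (mpoly.mderiv i p).

(* mmeasure mdeg p is 1 + deg p, and 0 if p = 0 *)
Definition Pi (k : nat) : set (sphere R m -> R) :=
  [set sphere_poly p | p in
    [set p | (mpoly.mmeasure (@mpoly.mdeg m.+1) p <= k.+1)%N]].

Definition Harm (k : nat) : set (sphere R m -> R) :=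
  [set sphere_poly p | p in
    [set p | p \is mpoly.ishomog1 k (@mpoly.mdeg m.+1) /\ laplacian p = 0]].

Definition dotw f g : R :=
  (fine (surface [set: sphere R m]))^-1 * \int[@surface R m]_x (f x * g x).

Definition normw2 f : \bar R :=
  ((fine (surface [set: sphere R m]))^-1%:E *
    \int[@surface R m]_x ((f x) ^+ 2)%:E)%E.

Definition harmonic_family := forall k : nat, 'I_(dimf (Harm k)) -> sphere R m -> R.

Definition orthonormal_harmonics (Y : harmonic_family) :=
  forall k, is_basis (Harm k) (Y k) /\
    forall i j, dotw (Y k i) (Y k j) = (i == j)%:R.

Definition coefficients := forall k : nat, 'I_(dimf (Harm k)) -> R.

Variable Y : harmonic_family.
Arguments Y : clear implicits.
Implicit Types (c : coefficients) (a w : nat -> R).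

Definition partial_expansion c (n : nat) : sphere R m -> R :=
  fun x => \sum_(k < n) \sum_j c k j * Y k j x.

Definition wnorm2 w c : \bar R :=
  (\sum_(0 <= k <oo) \sum_j (c k j ^+ 2 / w k)%:E)%E.

(* the elements of the reproducing kernel Hilbert space are functions: their
   expansion converges at every point *)
Definition HK_expansion a c f :=
  (forall x, partial_expansion c n x @[n --> \oo] --> f x) /\
  (wnorm2 a c < +oo)%E.

Definition HK_ball a (Q : R) : set (sphere R m -> R) :=
  [set f | exists2 c, HK_expansion a c f & (wnorm2 a c <= (Q ^+ 2)%:E)%E].

(* here the expansion converges in L^2 *)
Definition Sobolev a (r : R) : set (sphere R m -> R) :=
  [set f | measurable_fun setT f /\ exists c,
    normw2 (partial_expansion c n \- f) @[n --> \oo] --> 0%E /\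
    (wnorm2 (fun k => (a k `^ (2 * r))%R) c < +oo)%E].

End spherical_harmonics.

Section estimators.
Context (R : realType) (m : nat) d (Z : measurableType d).
Implicit Types (W : set (sphere R m -> R)) (n l : nat).

(* A (possibly randomized) encoder is a probability kernel from the samples to
   the codes; the deterministic ones are the Dirac kernels *)
Definition sized_estimator n l : Type :=
  (R.-pker (n.-tuple Z) ~> (l.-tuple bool)) * (l.-tuple bool -> sphere R m -> R).

Definition sized_estimators W n l : set (sized_estimator n l) :=
  [set G | forall b, W (G.2 b)].

(* E [w * ||G(sample) - f||^2] for n independent samples drawn from P *)
Definition risk n l (P : probability Z R) (w : R) (G : sized_estimator n l)
    (f : sphere R m -> R) : \bar R :=
  (\int[@tuple_measure _ _ R P n]_z \int[G.1 z]_b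
     (w%:E * normw2 (G.2 b \- f)%R))%E.

End estimators.

(* Main.v *)
(* Lower bound by coding.  Every finite spherical harmonic expansion lies in the
   Sobolev class, so only the RKHS ball matters.  Let K be the least degree for
   which there are at least 6 l harmonics Y_{k,j} with k <= K, and let M be their
   number.  The 2^M sign combinations of these harmonics with amplitude e,
   e^2 = Q^2 min_{k <= K} a_k / M, lie in the ball, and by orthonormality two of
   them are at squared distance 4 e^2 times the Hamming distance of their signs.
   The 2^l codewords of a decoder cannot come within squared distance e^2 M / 4
   of all of them, since a Hamming ball of radius M / 4 is too small.  As
   a_k >= c (dim Pi_k)^(-2s) and dim Pi_k = O(l) for k <= K, every decoder misses
   some target by at least c l^(-2s), whatever the encoder and the data law.

   Orthogonality of harmonics h, g of different degrees: integrating
   d/dx_i (p (1 - |x|^2)) = 0 over the unit ball and passing to polar coordinates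
   gives int_S d_i p = (d + k - 1) int_S x_i p for p homogeneous of degree k; with
   p = h d_i g and Euler's identity, int_S grad h . grad g equals both
   (d + k + l - 2) l int_S h g and (d + k + l - 2) k int_S h g. *)
Require Import Defs.
From HB Require Import structures.
From mathcomp Require Import all_boot all_order all_algebra.
From mathcomp Require Import all_classical all_reals all_analysis.
From mathcomp Require Import measurable_realfun.
From mathcomp Require mpoly.
Import (canonicals, coercions) mpoly.
From mathcomp Require Import ring lra zify.
Set Implicit Arguments.
Unset Strict Implicit.
Unset Printing Implicit Defensive.
Import Order.TTheory GRing.Theory Num.Theory.
Import numFieldNormedType.Exports.
Local Open Scope classical_set_scope.
Local Open Scope ring_scope.

(** * Scaling of Lebesgue measure on tuples *)

Section lebesgue_scaling.
Variable R : realType.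
Local Notation lam := (@lebesgue_measure R).
Local Notation mu n := (@tuple_measure _ _ R lam n).

Definition scale_tuple (t : R) n (x : n.-tuple R) : n.-tuple R :=
  [tuple t * tnth x i | i < n].

Lemma measurable_scale_tuple t n : measurable_fun setT (@scale_tuple t n).
Proof.
apply/measurable_fun_tnthP => i.
rewrite (_ : _ \o _ = (fun x : n.-tuple R => t * tnth x i)); last first.
  by apply/funext => x; rewrite /= tnth_mktuple.
by apply: measurable_funM => //; exact: measurable_tnth.
Qed.

Lemma scale_tuple_cons t n (x : R) (y : n.-tuple R) :
  scale_tuple t [tuple of x :: y] = [tuple of t * x :: scale_tuple t y].
Proof.
apply/eq_from_tnth => i; rewrite tnth_mktuple.
by case: (unliftP ord0 i) => [j|] -> ; rewrite ?tnthS ?tnth_mktuple ?tnth0.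
Qed.

Lemma measurable_mulrl (t : R) : measurable_fun setT (fun x : R => t * x).
Proof. exact: measurable_funM. Qed.

(** By uniqueness of Lebesgue measure: t times its image under x -> t x agrees with it on half-open
    intervals. *)
Lemma lebesgue_measure_scale (t : R) (A : set R) : 0 < t -> measurable A ->
  lam ((fun x => t * x) @^-1` A) = (t^-1%:E * lam A)%E.
Proof.
move=> t0 mA.
pose f (x : measurableTypeR R) : measurableTypeR R := t * x.
have mf : measurable_fun setT f by exact: measurable_mulrl.
have H : lam A = (t%:E * pushforward lam f A)%E.
  apply: (@lebesgue_measure_unique R (mscale (NngNum (ltW t0)) (pushforward lam f))) => // _ [[a b]] _ <-.
  rewrite [RHS](_ : _ = (t%:E * lam (f @^-1` `]a, b]))%E)//.
  have -> : f @^-1` `]a, b] = `](t^-1 * a)%R, (t^-1 * b)%R]%classic.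
    apply/seteqP; split=> x; rewrite /f /= !in_itv/= ?ltr_pdivrMl// ?ler_pdivlMl//.
  rewrite !lebesgue_measure_itv/= !lte_fin ltr_pM2l ?invr_gt0//.
  case: ifPn => _; last by rewrite mule0.
  by rewrite -!EFinB -EFinM -mulrBr mulVKf ?gt_eqF.
by rewrite H muleA -EFinM mulVf ?gt_eqF// mul1e.
Qed.

(** Induction on n, slicing along the first coordinate: the sections contribute t^-n and the
    substitution in the outer integral the last t^-1. *)
Lemma tuple_measure_scale (t : R) n (A : set (n.-tuple R)) :
  0 < t -> measurable A ->
  mu n (@scale_tuple t n @^-1` A) = ((t ^- n)%:E * mu n A)%E.
Proof.
move=> t0; elim: n A => [|n IH] A mA.
  have -> : @scale_tuple t 0 @^-1` A = A.
    by apply/seteqP; split => x; rewrite /preimage/= (tuple0 (scale_tuple t x)) (tuple0 x).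
  by rewrite expr0 invr1 mul1e.
pose c (p : R * n.-tuple R) : n.+1.-tuple R := [tuple of p.1 :: p.2].
have mc : measurable_fun setT c by apply: measurable_cons.
have mB : measurable (c @^-1` A) by rewrite -[X in measurable X]setTI; exact: mc.
pose h x := mu n (xsection (c @^-1` A) x).
have mh : measurable_fun setT h.
  exact: (@measurable_fun_xsection _ _ _ _ _ (mu n)).
pose f (x : measurableTypeR R) : measurableTypeR R := t * x.
have mf : measurable_fun setT f by exact: measurable_mulrl.
transitivity (\int[lam]_x ((t ^- n)%:E * (h \o f) x))%E.
  apply: eq_integral => x _ /=; rewrite -IH; last exact: measurable_xsection.
  congr (mu n _).
  by apply/seteqP; split => y; rewrite /xsection /= !inE /= /c /= scale_tuple_cons.
have tn0 : 0 <= t ^- n by rewrite invr_ge0 exprn_ge0// ltW.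
rewrite (ge0_integralZl_EFin (f1 := h \o f) _ _ _ _ tn0)//; last first.
  exact: measurableT_comp.
have it0 : 0 <= t^-1 by rewrite invr_ge0 ltW.
have -> : (\int[lam]_x (h \o f) x = t^-1%:E * \int[lam]_x h x)%E.
  transitivity (\int[pushforward lam f]_x h x)%E.
    by rewrite ge0_integral_pushforward// => x _; exact: measure_ge0.
  rewrite (eq_measure_integral (mscale (NngNum it0) lam)); last first.
    by move=> B mB' _; rewrite [LHS]lebesgue_measure_scale.
  by rewrite ge0_integral_mscale//=; move=> x _; exact: measure_ge0.
by rewrite muleA -EFinM exprS invfM mulrC.
Qed.

End lebesgue_scaling.

(** * Transfer and restriction of integrals *)

Section integral_complements.
Context d (T : measurableType d) (R : realType).

(** The change of variables is made on the positive and negative parts separately; integrability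
    keeps both finite, so that [fine] commutes with their difference. *)
Lemma Rintegral_transfer d' (T' : measurableType d')
    (mu : {measure set T -> \bar R}) (nu : {measure set T' -> \bar R})
    (phi : T -> T') (k : R) (D : set T') (f : T' -> R) :
  0 <= k -> measurable_fun setT phi -> measurable D -> measurable_fun setT f ->
  (forall A, measurable A -> A `<=` D -> nu A = (k%:E * mu (phi @^-1` A))%E) ->
  mu.-integrable (phi @^-1` D) (EFin \o (f \o phi)) ->
  \int[nu]_(y in D) f y = k * \int[mu]_(x in phi @^-1` D) f (phi x).
Proof.
move=> k0 mphi mD mf nuE fi.
have mf' : measurable_fun setT (EFin \o f) by exact/measurable_EFinP.
have mD' : measurable (phi @^-1` D).
  by rewrite -[X in measurable X]setTI; exact: mphi.
have fin_pos := integrable_pos_fin_num mD' fi.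
have fin_neg := integrable_neg_fin_num mD' fi.
have E (g : T' -> \bar R) : measurable_fun setT g -> (forall x, 0 <= g x)%E ->
    (\int[nu]_(y in D) g y = k%:E * \int[mu]_(x in phi @^-1` D) g (phi x))%E.
  move=> mg g0; have mgD : measurable_fun D g by exact: measurable_funTS.
  rewrite (eq_measure_integral (mscale (NngNum k0) (pushforward mu phi)))//.
  by rewrite ge0_integral_mscale// ge0_integral_pushforward.
rewrite /Rintegral integralE [in RHS]integralE !E//;
  [|exact: measurable_funeneg|exact: measurable_funepos].
have -> : (\int[mu]_(x in phi @^-1` D) (EFin \o f)^\+ (phi x) =
    \int[mu]_(x in phi @^-1` D) (EFin \o (f \o phi))^\+ x)%E.
  by apply: eq_integral => x _; rewrite !funeposE.
have -> : (\int[mu]_(x in phi @^-1` D) (EFin \o f)^\- (phi x) =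
    \int[mu]_(x in phi @^-1` D) (EFin \o (f \o phi))^\- x)%E.
  by apply: eq_integral => x _; rewrite !funenegE.
rewrite -muleBr ?fin_num_adde_defr//.
by rewrite fineM// fin_numB fin_pos fin_neg.
Qed.

Lemma ge0_integral_mrestr (mu : {measure set T -> \bar R}) (D : set T)
    (mD : measurable D) (f : T -> \bar R) :
  measurable_fun setT f -> (forall x, 0 <= f x)%E ->
  (\int[mrestr mu mD]_x f x = \int[mu]_(x in D) f x)%E.
Proof.
move=> mf f0; rewrite -(setvU D) ge0_integral_setU//; last 3 first.
- exact: measurableC.
- exact: measurable_funTS.
- by apply/disj_setPCr.

rewrite [X in (X + _)%E](eq_measure_integral mzero); last first.
  move=> A mA AD; transitivity (mu (A `&` D)) => //.
  by rewrite (_ : A `&` D = set0) ?measure0//; rewrite -subset0 => x [/AD].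
rewrite integral_measure_zero add0e; apply: eq_measure_integral => A mA AD.
transitivity (mu (A `&` D)) => //.
by congr (mu _); apply/setIidPl.
Qed.

Lemma Rintegral_mrestr (mu : {measure set T -> \bar R}) (D : set T)
    (mD : measurable D) (f : T -> R) :
  measurable_fun setT f ->
  \int[mrestr mu mD]_x f x = \int[mu]_(x in D) f x.
Proof.
move=> mf; have mf' : measurable_fun setT (EFin \o f) by exact/measurable_EFinP.
rewrite /Rintegral integralE [in RHS]integralE !ge0_integral_mrestr//.
exact: measurable_funeneg. exact: measurable_funepos.
Qed.

Lemma bounded_integrable (mu : {measure set T -> \bar R}) (D : set T) (f : T -> R) (M : R) :
  measurable D -> (mu D < +oo)%E -> measurable_fun D f ->
  (forall x, D x -> `|f x| <= M) -> mu.-integrable D (EFin \o f).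
Proof.
move=> mD Dfin mf fM; apply: measurable_bounded_integrable => //.
exists M; split; first exact: num_real.
by move=> y My x Dx; exact: le_trans (fM _ Dx) (ltW My).
Qed.

End integral_complements.

(** * Punctured balls *)

Section ball.
Variable R : realType.
Local Notation lam := (@lebesgue_measure R).
Local Notation mu n := (@tuple_measure _ _ R lam n).

Definition sqn n (x : n.-tuple R) : R := \sum_(i < n) tnth x i ^+ 2.

Lemma measurable_sqn n : measurable_fun setT (@sqn n).
Proof.
by apply: measurable_sum => i; apply: measurable_funX; exact: measurable_tnth.
Qed.

Lemma sqn_scale t n (x : n.-tuple R) : sqn (scale_tuple t x) = t ^+ 2 * sqn x.
Proof.
by rewrite /sqn mulr_sumr; apply: eq_bigr => i _; rewrite tnth_mktuple exprMn.
Qed.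

Lemma sqn_ge0 n (x : n.-tuple R) : 0 <= sqn x.
Proof. by apply: sumr_ge0 => i _; exact: sqr_ge0. Qed.

Lemma tnth_sqn n (x : n.-tuple R) i : tnth x i ^+ 2 <= sqn x.
Proof. by rewrite /sqn (bigD1 i)//= lerDl sumr_ge0// => j _; exact: sqr_ge0. Qed.

(* the origin is left out: the radial projection is discontinuous there *)
Definition pball (n : nat) (t : R) : set (n.-tuple R) := [set x | 0 < sqn x <= t ^+ 2].
Arguments pball : clear implicits.

Lemma measurable_pball n t : measurable (pball n t).
Proof.
rewrite (_ : pball n t = @sqn n @^-1` `]0, (t ^+ 2)]); last first.
  by apply/seteqP; split=> x /=; rewrite in_itv.
by rewrite -[X in measurable X]setTI; exact: measurable_sqn.
Qed.

(** Serves to bound the measure of the unit ball; the cube is a product of intervals of length 2. *)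
Lemma tuple_cube_fin n :
  measurable [set x : n.-tuple R | forall i, tnth x i \in `[-1, 1]] /\
  (mu n [set x : n.-tuple R | forall i, tnth x i \in `[-1, 1]%R] < +oo)%E.
Proof.
set C := fun n => [set x : n.-tuple R | forall i, tnth x i \in `[-1, 1]].
rewrite -/(C n); have mC : forall n, measurable (C n).
  move=> {}n; rewrite (_ : C n = \bigcap_(i : 'I_n) (fun x => tnth x i) @^-1` `[-1, 1]).
    apply: fin_bigcap_measurable; first exact: finite_finset.
    by move=> i _; rewrite -[X in measurable X]setTI; exact: measurable_tnth.
  by apply/seteqP; split => [x Cx i _|x Cx i]; exact: Cx.
split=> //; elim: n => [|n IH].
  by rewrite /= diracE; case: (_ \in _) => /=; rewrite ltry.
rewrite /= /pushforward (_ : _ @^-1` _ = `[-1, 1]%classic `*` C n).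
  rewrite product_measure1E//; last exact: mC.
  rewrite [X in (X * _)%E](_ : _ = 2%:E); last first.
    by rewrite [LHS]lebesgue_measure_itv/= lte_fin gtrN// -EFinB opprK.
  by rewrite lte_mul_pinfty// lee_fin; lra.
apply/seteqP; split=> [[x y] /= Cxy|[x y] [/= Cx Cy] i].
  split; first by have := Cxy ord0; rewrite tnth0.
  by move=> i; have := Cxy (lift ord0 i); rewrite tnthS.
by case: (unliftP ord0 i) => [j|] ->; rewrite ?tnthS ?tnth0//; exact: Cy.
Qed.

Lemma pball1_fin n : (mu n (pball n 1) < +oo)%E.
Proof.
have [mC] := tuple_cube_fin n; apply: le_lt_trans.
apply: le_measure; rewrite ?inE//; first exact: measurable_pball.
move=> x /= /andP[_ x1] i; rewrite in_itv/= -ler_norml -(@expr_le1 _ 2)// real_normK ?num_real//.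
by rewrite (le_trans (tnth_sqn x i))// (le_trans x1)// expr1n.
Qed.

Lemma preimage_scale_pball n (t : R) : 0 < t -> @scale_tuple R t n @^-1` pball n t = pball n 1.
Proof.
move=> t0; have t2 : 0 < t ^+ 2 by rewrite exprn_gt0.
by apply/seteqP; split => x; rewrite /pball /= sqn_scale expr1n pmulr_rgt0// ger_pMr.
Qed.

Lemma Rintegral_pball_scale n (t M : R) (f : n.-tuple R -> R) : 0 < t ->
  measurable_fun setT f -> (forall x, pball n t x -> `|f x| <= M) ->
  \int[mu n]_(x in pball n t) f x =
  t ^+ n * \int[mu n]_(x in pball n 1) f (scale_tuple t x).
Proof.
move=> t0 mf fM.
rewrite -(preimage_scale_pball n t0).
have tn0 : 0 < t ^+ n by rewrite exprn_gt0.
apply: Rintegral_transfer => //.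
- exact: ltW.
- exact: measurable_scale_tuple.
- exact: measurable_pball.
- move=> A mA _; have E := @tuple_measure_scale R t n A t0 mA.
  transitivity ((t ^+ n)%:E * ((t ^- n)%:E * mu n A))%E.
    by rewrite muleA -EFinM mulfV ?gt_eqF// mul1e.
  by congr (_ * _)%E; exact: esym E.
- rewrite preimage_scale_pball//; apply: (@bounded_integrable _ _ _ _ _ _ M).
  + exact: measurable_pball.
  + exact: pball1_fin.
  + by apply: measurable_funTS; apply: measurableT_comp => //; exact: measurable_scale_tuple.
  + by move=> x; rewrite -(preimage_scale_pball n t0) => /fM.
Qed.

End ball.
Arguments pball {R}.

(** * Polar coordinates *)

Section polar.
Variables (R : realType) (m : nat).
Local Notation mu := (@tuple_measure _ _ R (@lebesgue_measure R) m.+1).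
Local Notation surf := (@surface R m).

(** The origin has no direction: its rescaling is 0, off the sphere, so [insubd] sends it to the
    pole. *)
Definition radial (x : m.+1.-tuple R) : sphere R m :=
  insubd (sphere_pole R m : {x : m.+1.-tuple R | \sum_(i < m.+1) tnth x i ^+ 2 == 1})
    (scale_tuple (Num.sqrt (sqn x))^-1 x).

Lemma sqn_sphere (y : sphere R m) : sqn (sval y) = 1.
Proof. by apply/eqP; exact: svalP y. Qed.

Lemma sval_radial x : 0 < sqn x -> sval (radial x) = scale_tuple (Num.sqrt (sqn x))^-1 x.
Proof.
move=> x0; apply: insubdK; rewrite unfold_in; apply/eqP.
rewrite -/(sqn _) sqn_scale exprVn sqr_sqrtr ?ltW// mulVf// gt_eqF//.
Qed.

Lemma measurable_sval : measurable_fun setT (fun y : sphere R m => sval y).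
Proof. by move=> _ B mB; exists B. Qed.

Lemma measurable_radial : measurable_fun setT radial.
Proof.
move=> _ _ [B mB <-]; rewrite !setTI.
rewrite -[X in measurable X]setTI -comp_preimage.
suff : measurable_fun setT ((fun y : sphere R m => sval y) \o radial) by apply.
apply/measurable_fun_tnthP => i.
pose g (x : m.+1.-tuple R) := (sqn x `^ (1/2))^-1 * tnth x i.
have -> : (@tnth _ _)^~ i \o ((fun y : sphere R m => sval y) \o radial) =
  (fun x => if 0 < sqn x then g x else tnth (sval (sphere_pole R m)) i).
  apply/funext => x /=; case: ifPn => [x0|].
    by rewrite sval_radial// tnth_mktuple /g div1r powR12_sqrt// ltW.
  rewrite lt_neqAle sqn_ge0 andbT negbK => /eqP x0.
  rewrite /radial /insubd insubF//= -/(sqn _) sqn_scale -x0 mulr0.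
  by apply/negP; rewrite eq_sym oner_eq0.
apply: measurable_fun_ifT => //.
- apply: measurable_fun_ltr => //; exact: measurable_sqn.
- rewrite (_ : g = (fun x => sqn x `^ (- (1/2)) * tnth x i)); last first.
    by apply/funext => x; rewrite /g powRN.
  apply: measurable_funM; last exact: measurable_tnth.
  exact: (measurableT_comp (measurable_powR _) (@measurable_sqn R m.+1)).
Qed.

(** Exhibits [surface] as m + 1 times the image under [radial] of Lebesgue measure on the punctured
    unit ball. *)
Lemma coneE (A : set (sphere R m)) : cone A = pball m.+1 1 `&` radial @^-1` A.
Proof.
have sval_inj (y z : sphere R m) : sval y = sval z -> y = z by exact: val_inj.
apply/seteqP; split => [x [y Ay [t /andP[t0 t1] xt]]|x [/= /andP[x0 x1] Ax]].
  have xE : x = scale_tuple t (sval y).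
    by apply/eq_from_tnth => i; rewrite tnth_mktuple xt.
  have sx : sqn x = t ^+ 2 by rewrite xE sqn_scale sqn_sphere mulr1.
  have x0 : 0 < sqn x by rewrite sx exprn_gt0.
  split; first by rewrite /pball /= x0 sx ler_pXn2r// ?nnegrE ?ltW//.
  rewrite /preimage/= (_ : radial x = y)//; apply: sval_inj.
  rewrite sval_radial// sx sqrtr_sqr gtr0_norm//.
  by apply/eq_from_tnth => i; rewrite tnth_mktuple xt mulKf// gt_eqF.
have s0 : 0 < Num.sqrt (sqn x) by rewrite sqrtr_gt0.
exists (radial x) => //; exists (Num.sqrt (sqn x)).
  by rewrite s0/= -(sqrtr1 R) ler_wsqrtr// -(expr1n _ 2).
by move=> i; rewrite sval_radial// tnth_mktuple mulVKf// gt_eqF.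
Qed.

Lemma Rintegral_surface (f : sphere R m -> R) (M : R) : measurable_fun setT f ->
  (forall y, `|f y| <= M) ->
  \int[surf]_y f y = m.+1%:R * \int[mu]_(x in pball m.+1 1) f (radial x).
Proof.
move=> mf fM.
have mB := @measurable_pball R m.+1 1.
transitivity (m.+1%:R * \int[mrestr mu mB]_(x in radial @^-1` setT) f (radial x)).
  apply: Rintegral_transfer => //; first exact: measurable_radial.
    move=> A mA _; transitivity (m.+1%:R%:E * mu (cone A))%E => //.
    by rewrite coneE setIC.
  rewrite preimage_setT; apply: (@bounded_integrable _ _ _ _ _ _ M) => //.
  - rewrite [X in (X < _)%E](_ : _ = mu (setT `&` pball m.+1 1))// setTI.
    exact: pball1_fin.
  - by apply: measurableT_comp => //; exact: measurable_radial.
  - by move=> x _; exact: fM.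
congr (_ * _); rewrite preimage_setT; apply: Rintegral_mrestr.
by apply: measurableT_comp => //; exact: measurable_radial.
Qed.

Lemma surface_fin : (surf setT < +oo)%E.
Proof.
rewrite /= /surface coneE preimage_setT setIT.
by rewrite lte_mul_pinfty// ?lee_fin//; exact: pball1_fin.
Qed.

(** The small ball is a rescaled unit ball, so by homogeneity it carries the fraction t^(d + k) of
    the whole integral. The case k = 0 serves for functions constant along rays. *)
Lemma annulus_integral (k : nat) (h : m.+1.-tuple R -> R) (t M : R) :
  0 < t < 1 -> measurable_fun setT h ->
  (forall x, pball m.+1 1 x -> h (scale_tuple t x) = t ^+ k * h x) ->
  (forall x, pball m.+1 1 x -> `|h x| <= M) ->
  \int[mu]_(x in pball m.+1 1 `\` pball m.+1 t) h x =
  (1 - t ^+ (m.+1 + k)) * \int[mu]_(x in pball m.+1 1) h x.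
Proof.
move=> /andP[t0 t1] mh hh hM.
have mB u : measurable (pball m.+1 (u : R)) by exact: measurable_pball.
have sub1 : pball m.+1 t `<=` pball m.+1 (1 : R).
  move=> x /= /andP[x0 xt]; rewrite /pball/= x0/= (le_trans xt)//.
  by rewrite ler_pXn2r// ?nnegrE ltW.
have ih : mu.-integrable (pball m.+1 1) (EFin \o h).
  apply: (@bounded_integrable _ _ _ _ _ _ M) => //.
  - exact: mB.
  - exact: pball1_fin.
  - exact: measurable_funTS.
have E : pball m.+1 1 = (pball m.+1 1 `\` pball m.+1 t) `|` pball m.+1 t.
  by rewrite setUC setDUK.
have spl : \int[mu]_(x in pball m.+1 1) h x =
    \int[mu]_(x in pball m.+1 1 `\` pball m.+1 t) h x + \int[mu]_(x in pball m.+1 t) h x.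
  rewrite [in LHS]E Rintegral_setU//.
  - by apply: measurableD; exact: mB.
  - exact: mB.
  - by rewrite -E.
  - by apply/disj_set2P; rewrite setDE -setIA setICl setI0.
rewrite mulrBl mul1r [in X in _ = X - _]spl.
have -> : \int[mu]_(x in pball m.+1 t) h x = t ^+ (m.+1 + k) * \int[mu]_(x in pball m.+1 1) h x.
  rewrite (@Rintegral_pball_scale _ _ _ M)//; last by move=> x /sub1; exact: hM.
  rewrite exprD -mulrA; congr (_ * _).
  rewrite -RintegralZl//; last exact: mB.
  by apply: eq_Rintegral => x; rewrite inE => /hh.
by rewrite addrK.
Qed.

(** Divide by 1 - t and let t -> 1: (1 - t^n) / (1 - t) tends to n, while the right side keeps the
    vanishing factor 1 - t^j. *)
Lemma geometric_limit (a b j : nat) (x y C : R) :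
  (forall t : R, 0 < t < 1 ->
    `|(1 - t ^+ a) * x - (1 - t ^+ b) * y| <= (1 - t ^+ j) * ((1 - t ^+ b) * C)) ->
  a%:R * x = b%:R * y.
Proof.
move=> H; pose u n (t : R) := \sum_(i < n) t ^+ i.
have uE n t : 1 - t ^+ n = (1 - t) * u n t by rewrite -opprB subrX1 -mulNr opprB.
have u1 n : u n 1 = n%:R.
  by rewrite /u (eq_bigr (fun _ => 1)) ?sumr_const ?card_ord// => i _; rewrite expr1n.
have cu n : continuous (u n).
  rewrite (_ : u n = horner (\sum_(i < n) 'X^i)); first exact: continuous_horner.
  by apply/funext => t; rewrite horner_sum; apply: eq_bigr => i _; rewrite hornerXn.
(* The slack of the assumed inequality after division by 1 - t; continuity carries its sign to t =
   1. *)
pose h t := (1 - t ^+ j) * (u b t * C) - `|u a t * x - u b t * y|.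
have ch : h @ (1 : R)^'- --> h 1.
  apply: cvg_at_left_filter; apply: cvgB.
    apply: cvgM; last by apply: cvgMl; exact: cu.
    by apply: cvgB; [exact: cvg_cst|exact: exprn_continuous].
  by apply: cvg_norm; apply: cvgB; apply: cvgMl; exact: cu.
have h0 : 0 <= h 1.
  apply: (cvgr_to_ge ch); near=> t.
  have t01 : 0 < t < 1.
    by apply/andP; split; near: t; [exact: nbhs_left_gt|exact: nbhs_left_lt].
  have /andP[t0 t1] := t01; have := H _ t01.
  rewrite (uE a) (uE b) -!mulrA -mulrBr normrM gtr0_norm ?subr_gt0//.
  rewrite mulrCA ler_pM2l ?subr_gt0//.
  by rewrite /h subr_ge0 mulrA.
move: h0; rewrite /h !u1 expr1n subrr mul0r sub0r oppr_ge0 normr_le0 subr_eq0.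
by move=> /eqP.
Unshelve. all: by end_near.
Qed.

(* With g x = q (x / |x|), the integrals of q and g over the annulus t < |x| <= 1
   are 1 - t ^+ (d + j) and 1 - t ^+ d times those over the ball, and there
   |q - g| <= (1 - t ^+ j) M on a set of measure O(1 - t); let t -> 1. *)
Lemma polar_integral (j : nat) (q : m.+1.-tuple R -> R) (M : R) :
  measurable_fun setT q ->
  (forall t x, 0 < t -> q (scale_tuple t x) = t ^+ j * q x) ->
  (forall x, sqn x <= 1 -> `|q x| <= M) ->
  \int[surf]_y q (sval y) = (m.+1 + j)%:R * \int[mu]_(x in pball m.+1 1) q x.
Proof.
move=> mq hq qM.
have mqs : measurable_fun setT (fun y : sphere R m => q (sval y)).
  by apply: measurableT_comp => //; exact: measurable_sval.
rewrite (@Rintegral_surface _ M)//; last by move=> y; apply: qM; rewrite sqn_sphere.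
pose g (x : m.+1.-tuple R) := q (sval (radial x)).
have mg : measurable_fun setT g.
  exact: (measurableT_comp mqs measurable_radial).
have gM x : `|g x| <= M by apply: qM; rewrite sqn_sphere.
have gq x : 0 < sqn x -> q x = Num.sqrt (sqn x) ^+ j * g x.
  move=> x0; rewrite /g sval_radial// -hq ?sqrtr_gt0//; congr q.
  apply/eq_from_tnth => i; rewrite !tnth_mktuple mulVKf// gt_eqF// sqrtr_gt0//.
have g_scale t x : 0 < t -> 0 < sqn x -> g (scale_tuple t x) = g x.
  move=> t0 x0; have tx0 : 0 < sqn (scale_tuple t x) by rewrite sqn_scale mulr_gt0// exprn_gt0.
  rewrite /g !sval_radial//; congr q; apply/eq_from_tnth => i.
  rewrite !tnth_mktuple sqn_scale sqrtrM ?sqr_ge0// sqrtr_sqr gtr0_norm// invfM.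
  by rewrite mulrACA mulVf ?mul1r// gt_eqF.
have qball x : pball m.+1 1 x -> `|q x| <= M by move=> /= /andP[_]; rewrite expr1n; exact: qM.
apply/esym; apply: (@geometric_limit _ _ j _ _ (M * fine (mu (pball m.+1 1)))) => t t01.
have /andP[t0 t1] := t01.
have mA : measurable (pball m.+1 1 `\` pball m.+1 t).
  by apply: measurableD; exact: measurable_pball.
have iA (h : m.+1.-tuple R -> R) N : measurable_fun setT h ->
    (forall x, pball m.+1 1 x -> `|h x| <= N) ->
    mu.-integrable (pball m.+1 1 `\` pball m.+1 t) (EFin \o h).
  move=> mh hN; apply: (@bounded_integrable _ _ _ _ _ _ N) => //.
  - apply: le_lt_trans (@pball1_fin R m.+1); apply: le_measure; rewrite ?inE//.
    exact: measurable_pball.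
  - exact: measurable_funTS.
  - by move=> x [+ _]; exact: hN.
have iq := iA q M mq qball; have ig := iA g M mg (fun x _ => gM x).
rewrite -(@annulus_integral j q t M)//; last by move=> x _; exact: hq.
have := @annulus_integral 0 g t M t01 mg; rewrite addn0 => <-//; last first.
  by move=> x /= /andP[x0 _]; rewrite expr0 mul1r g_scale.
rewrite -RintegralB//; apply: (le_trans (le_normr_Rintegral _ _)) => //.
  exact: (iA _ _ (measurable_funB mq mg) (fun x px => le_trans (ler_normB _ _) (lerD (qball x px) (gM x)))).
(* The error bound is the annulus integral of a constant, homogeneous of degree 0. *)
have -> : (1 - t ^+ j) * ((1 - t ^+ m.+1) * (M * fine (mu (pball m.+1 1)))) =
    \int[mu]_(x in pball m.+1 1 `\` pball m.+1 t) ((1 - t ^+ j) * M).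
  have := @annulus_integral 0 (cst ((1 - t ^+ j) * M)) t `|(1 - t ^+ j) * M| t01.
  rewrite addn0 => -> //; last by move=> x _; rewrite expr0 mul1r.
  rewrite Rintegral_cst; last exact: measurable_pball.
  by ring.
apply: le_Rintegral => //.
- apply: (iA (fun x => `|q x - g x|) (M + M)).
    by apply: measurableT_comp => //; exact: measurable_funB.
  by move=> x px; rewrite normr_id (le_trans (ler_normB _ _))// lerD// qball.
- exact: (iA (cst _) `|(1 - t ^+ j) * M|).
move=> x [/= /andP[x0 x1] /negP]; rewrite x0/= -ltNge => tx.
have M0 : 0 <= M by rewrite (le_trans _ (gM x)).
have t_le : t <= Num.sqrt (sqn x).
  by rewrite -(ger0_norm (ltW t0)) -sqrtr_sqr ler_wsqrtr// ltW.
have le_1 : Num.sqrt (sqn x) <= 1.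
  by rewrite -(sqrtr1 R) ler_wsqrtr// -(expr1n _ 2).
rewrite gq// -{2}(mul1r (g x)) -mulrBl normrM ler_pM//.
rewrite distrC ger0_norm ?subr_ge0 ?exprn_ile1 ?sqrtr_ge0//.
by rewrite lerB// lerXn2r// nnegrE ?sqrtr_ge0// ltW.
Qed.

End polar.

(** * Divergence theorem on the ball *)

Section coordinate_integration.
Variable R : realType.
Local Notation lam := (@lebesgue_measure R).
Local Notation mu n := (@tuple_measure _ _ R lam n).

Definition upd n (x : n.-tuple R) (i : 'I_n) (u : R) : n.-tuple R :=
  [tuple if j == i then u else tnth x j | j < n].

Lemma upd_cons0 n (x : R) (y : n.-tuple R) u :
  upd [tuple of x :: y] ord0 u = [tuple of u :: y].
Proof.
apply/eq_from_tnth => i; rewrite tnth_mktuple.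
by case: (unliftP ord0 i) => [j|] ->; rewrite ?tnthS ?tnth0.
Qed.

Lemma upd_consS n (x : R) (y : n.-tuple R) j u :
  upd [tuple of x :: y] (lift ord0 j) u = [tuple of x :: upd y j u].
Proof.
apply/eq_from_tnth => i; rewrite tnth_mktuple.
case: (unliftP ord0 i) => [k|] ->; rewrite ?tnthS ?tnth0//.
by rewrite (inj_eq lift_inj) tnth_mktuple.
Qed.

(** Fubini, by induction on the dimension: either coordinate i is the first one and is integrated
    innermost, or the first one is frozen and the claim is applied to the tail. *)
Lemma integral_coordinate_eq0 n (i : 'I_n) (F : n.-tuple R -> R) :
  (mu n).-integrable setT (EFin \o F) ->
  (forall x, \int[lam]_u (F (upd x i u))%:E = 0)%E ->
  (\int[mu n]_x (F x)%:E = 0)%E.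
Proof.
elim: n i F => [[]//|n IH] i F iF F0.
pose T := measurableTypeR R.
pose c (p : T * n.-tuple T) : n.+1.-tuple T := [tuple of p.1 :: p.2].
have mc : measurable_fun setT c by apply: measurable_cons.
have mF : measurable_fun setT F by apply/measurable_EFinP; exact: measurable_int iF.
have mF' : measurable_fun setT (EFin \o F) by exact/measurable_EFinP.
have mFc : measurable_fun setT (EFin \o F \o c) by exact: measurableT_comp.
have ic : (lam \x mu n)%E.-integrable setT (EFin \o F \o c).
  apply/integrableP; split => //.
  have /integrableP[_] := iF; congr (_ < _)%E.
  transitivity (\int[pushforward (lam \x mu n)%E c]_x `|(F x)%:E|)%E; first reflexivity.
  by rewrite ge0_integral_pushforward//; apply: measurableT_comp mF'.
transitivity (\int[pushforward (lam \x mu n)%E c]_x (F x)%:E)%E; first reflexivity.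
rewrite integral_pushforward//.
case: (unliftP ord0 i) => [j|] ij; rewrite ij in F0.
  rewrite preimage_setT -(integral12_prod_meas1 ic).
  rewrite (ae_eq_integral (cst 0%E))//; first by rewrite integral0.
  - exact: (measurable_fubini_F ic).
  (* Sections of an integrable function are integrable only for almost every x. *)
  - apply: filterS (ae_integrable1 ic) => x ix _.
    apply: (IH j (fun y => F (c (x, y)))) => //.
    move=> y; rewrite -[RHS](F0 (c (x, y))).
    by apply: eq_integral => u _; rewrite /c /= upd_consS.
rewrite preimage_setT -(integral21_prod_meas1 ic).
rewrite integral0_eq// => y _.
rewrite -[RHS](F0 (c (0, y))).
by apply: eq_integral => u _; rewrite /c /= upd_cons0.
Qed.

(** With c the squared norm of the other coordinates, a line parallel to an axis meets the ball in
    [-b, b], b^2 = 1 - c. The factor 1 - c - u^2 vanishes at both ends, so the fundamental theorem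
    of calculus gives 0. *)
Lemma integral_deriv_ball_section (q : {poly R}) (c : R) : 0 <= c ->
  (\int[lam]_(u in [set u : R | (0 < c + u ^+ 2 <= 1)%R])
    (((q * ((1 - c)%:P - 'X^2))^`()).[u]%R)%:E = 0)%E.
Proof.
move=> c0; set G := q * _.
have mG (A : set R) : measurable_fun A (fun u => ((G^`()).[u]%R)%:E).
  apply/measurable_EFinP; apply: measurable_funTS; apply: continuous_measurable_fun.
  exact: continuous_horner.
have [c1|c1] := ltP 1 c.
  rewrite (_ : [set u | _] = set0) ?integral_set0// -subset0 => u /= /andP[_].
  by apply/negP; rewrite -ltNge ltr_wpDr// sqr_ge0.
pose b := Num.sqrt (1 - c).
have b0 : 0 <= b by exact: sqrtr_ge0.
have bb : b ^+ 2 = 1 - c by rewrite sqr_sqrtr// subr_ge0.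
have le_b u : (c + u ^+ 2 <= 1) = (u \in `[- b, b]).
  rewrite in_itv/= -ler_norml -lerBrDl -bb -[u ^+ 2]real_normK ?num_real//.
  by rewrite ler_pXn2r ?nnegrE.
have main : (\int[lam]_(u in `[(- b)%R, b]) ((G^`()).[u]%R)%:E = 0)%E.
  move: b0; rewrite le_eqVlt => /predU1P[<-|b0].
    by rewrite oppr0 set_itv1 integral_set1.
  rewrite (@continuous_FTC2 _ _ (horner G)).
  - rewrite -EFinB; congr EFin.
    by rewrite /G !hornerM !hornerD !hornerN !hornerXn !hornerC sqrrN bb; ring.
  - by rewrite gtrN.
  - apply: continuous_subspaceT; exact: continuous_horner.
  - split.
    + by move=> x _; exact: derivable_horner.
    + by apply: cvg_at_right_filter; exact: continuous_horner.
    + by apply: cvg_at_left_filter; exact: continuous_horner.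
  - by move=> x _; rewrite derivE.
have [c_gt0|] := ltP 0 c.
  rewrite -[RHS]main; congr integral; apply/seteqP; split=> u /=; rewrite le_b.
    by case/andP.
  by move=> ->; rewrite andbT ltr_wpDr// sqr_ge0.
(* The line passes through the origin, which the punctured ball omits; a single point is null. *)
move=> c_le0; have {c_le0} cE : c = 0 by apply/eqP; rewrite eq_le c_le0 c0.
rewrite -[RHS]main [in LHS](_ : [set u | _] = `[- b, b] `\ 0).
  rewrite integral_setD1//.
  by apply: measurableD; [exact: measurable_itv|exact: measurable_set1].
apply/seteqP; split=> u /=; rewrite le_b cE add0r.
  by move=> /andP[u0 ->]; split => //= u00; rewrite u00 expr0n ltxx in u0.
by move=> [-> /eqP u0]; rewrite andbT exprn_even_gt0//= u0.
Qed.

End coordinate_integration.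

(** * Polynomials and their slices along coordinate lines *)

Section polynomials.
Variables (R : realType) (n : nat).
Local Notation MP := (mpoly.mpoly n R).
Local Notation lam := (@lebesgue_measure R).
Local Notation mu := (@tuple_measure _ _ R lam n).
Implicit Types p q : MP.

Definition peval p (x : n.-tuple R) : R := mpoly.meval (tnth x) p.

Definition psqn : MP := \sum_(i < n) mpoly.mpolyX R (mpoly.mnm1 i) ^+ 2.

Lemma peval_sqn x : peval psqn x = sqn x.
Proof.
rewrite /peval /psqn raddf_sum; apply: eq_bigr => i _.
by rewrite expr2 /= mpoly.mevalM mpoly.mevalXU.
Qed.

Lemma measurable_peval p : measurable_fun setT (peval p).
Proof.
rewrite (_ : peval p = fun x =>
  \sum_(m <- mpoly.msupp p) mpoly.mcoeff m p * \prod_i tnth x i ^+ m i); last first.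
  by apply/funext => x; rewrite /peval mpoly.mevalE.
apply: measurable_sum => m; apply: measurable_funM => //.
apply: measurable_prod => i _; apply: measurable_funX; exact: measurable_tnth.
Qed.

Lemma peval_bounded p : exists M, forall x, sqn x <= 1 -> `|peval p x| <= M.
Proof.
exists (\sum_(m <- mpoly.msupp p) `|mpoly.mcoeff m p|) => x x1.
rewrite /peval mpoly.mevalE (le_trans (ler_norm_sum _ _ _))//.
apply: ler_sum => m _; rewrite normrM ler_piMr// normr_prod.
suff : \prod_(i < n) `|tnth x i ^+ m i| <= \prod_(i < n) (1 : R) by rewrite big1_eq.
apply: ler_prod => i _; rewrite normr_ge0/= normrX exprn_ile1//.
rewrite -(@expr_le1 _ 2)// real_normK ?num_real//.
exact: le_trans (tnth_sqn x i) x1.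
Qed.

(** The restriction of p to the line through x parallel to axis i, as a univariate polynomial; it
    turns partial derivatives into formal ones. *)
Definition pslice (x : n.-tuple R) (i : 'I_n) p : {poly R} :=
  mpoly.mmap (@polyC R) (fun j => if j == i then 'X else (tnth x j)%:P) p.

Lemma peval_upd x i u p : peval p (upd x i u) = (pslice x i p).[u].
Proof.
rewrite /peval /pslice mpoly.mevalE /mpoly.mmap horner_sum; apply: eq_bigr => m _.
rewrite hornerM hornerC; congr (_ * _); rewrite /mpoly.mmap1 horner_prod.
apply: eq_bigr => j _; rewrite tnth_mktuple horner_exp.
by case: eqP => _; rewrite ?hornerX ?hornerC.
Qed.

Lemma pslice_deriv x i p : pslice x i (mpoly.mderiv i p) = (pslice x i p)^`().
Proof.
rewrite /pslice; elim/mpoly.mpolyind: p => [|c m p _ _ IH].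
  by rewrite mpoly.mderiv0 !mpoly.mmap0 deriv0.
rewrite mpoly.mderivD mpoly.mderivZ mpoly.mderivX !mpoly.mmapD IH derivD.
congr (_ + _); rewrite !mpoly.mmapZ !mpoly.mmapX derivM derivC mul0r add0r.
congr (_ * _); rewrite /mpoly.mmap1 (bigD1 i)//= [in RHS](bigD1 i)//= eqxx.
rewrite mpoly.mnmBE mpoly.mnm1E eqxx.
set P := \prod_(j | _) _; set Q := \prod_(j | _) _.
have [c' QE] : exists c', Q = c'%:P.
  exists (\prod_(j < n | j != i) tnth x j ^+ m j).
  rewrite rmorph_prod; apply: eq_bigr => j /negPf ->; by rewrite rmorphXn.
have -> : P = Q.
  by apply: eq_bigr => j ji; rewrite mpoly.mnmBE mpoly.mnm1E [i == j]eq_sym (negPf ji) subn0.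
by rewrite derivM QE derivC mulr0 addr0 derivXn subn1 mulrA -[in RHS]mulr_natl rmorph_nat.
Qed.

Lemma pslice_sqn x i : exists2 c, 0 <= c &
  pslice x i psqn = c%:P + 'X^2 /\ forall u, sqn (upd x i u) = c + u ^+ 2.
Proof.
exists (\sum_(j < n | j != i) tnth x j ^+ 2).
  by apply: sumr_ge0 => j _; exact: sqr_ge0.
split.
  rewrite /pslice /psqn raddf_sum (bigD1 i)//= addrC; congr (_ + _).
    rewrite rmorph_sum; apply: eq_bigr => j /negPf ji.
    by rewrite rmorphXn/= mpoly.mmapX mpoly.mmap1U ji rmorphXn.
  by rewrite rmorphXn/= mpoly.mmapX mpoly.mmap1U eqxx.
move=> u; rewrite /sqn (bigD1 i)//= tnth_mktuple eqxx addrC; congr (_ + _).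
by apply: eq_bigr => j /negPf ji; rewrite tnth_mktuple ji.
Qed.

Lemma integrable_pball p : mu.-integrable (pball n 1) (EFin \o peval p).
Proof.
have [M pM] := peval_bounded p.
apply: (@bounded_integrable _ _ _ _ _ _ M).
- exact: measurable_pball.
- exact: pball1_fin.
- by apply: measurable_funTS; exact: measurable_peval.
- by move=> x /= /andP[_]; rewrite expr1n; exact: pM.
Qed.

(* the factor 1 - |x|^2 kills the boundary terms of the divergence theorem *)
Lemma Rintegral_deriv_ball p i :
  \int[mu]_(x in pball n 1) peval (mpoly.mderiv i (p * (1 - psqn))) x = 0.
Proof.
set q := mpoly.mderiv i _.
have mB : measurable (pball n (1 : R)) by exact: measurable_pball.
rewrite Rintegral_mkcond /Rintegral.
rewrite (@integral_coordinate_eq0 R n i)//.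
  have := integrable_pball q; rewrite integrable_mkcond// => H.
  by rewrite -restrict_EFin.
move=> x; have [c c0 [sE nE]] := pslice_sqn x i.
pose A := [set u : R | (0 < c + u ^+ 2 <= 1)%R].
rewrite -[RHS](integral_deriv_ball_section (pslice x i p) c0) [in RHS]integral_mkcond.
apply: eq_integral => u _; rewrite !patchE.
have -> : (upd x i u \in pball n 1) = (u \in A).
  by apply/idP/idP; rewrite !inE /pball/= nE expr1n.
rewrite -/A; case: ifPn => // _; congr EFin; rewrite /q peval_upd pslice_deriv; congr (_^`()).[_].
by rewrite /pslice rmorphM rmorphB rmorph1/= -/(pslice x i p) -/(pslice x i psqn) sE polyCB opprD addrA.
Qed.

End polynomials.

(** * Orthogonality of spherical harmonics *)

Section homogeneous.
Variables (R : realType) (n : nat).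
Local Notation MP := (mpoly.mpoly n R).
Local Notation homog k := (mpoly.ishomog1 k (@mpoly.mdeg n)).
Local Notation X i := (mpoly.mpolyX R (mpoly.mnm1 i)).
Implicit Types p q : MP.

Lemma dhomog_mdeg k p m : p \is homog k -> m \in mpoly.msupp p -> mpoly.mdeg m = k.
Proof. by move=> /mpoly.dhomogP hp /hp. Qed.

Lemma peval_homog k p t x : p \is homog k ->
  peval p (scale_tuple t x) = t ^+ k * peval p x.
Proof.
move=> hp; rewrite /peval !mpoly.mevalE mulr_sumr.
apply: eq_big_seq => m /(dhomog_mdeg hp) <-; rewrite mulrCA; congr (_ * _).
rewrite mpoly.mdegE -prodrXr -big_split/=.
by apply: eq_bigr => i _; rewrite tnth_mktuple exprMn.
Qed.

Lemma dhomogXi i : X i \is homog 1.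
Proof. by rewrite mpoly.dhomogX; apply/eqP; exact: mpoly.mdeg1. Qed.

Lemma dhomog_sqn : psqn R n \is homog 2.
Proof.
apply: rpred_sum => i _; rewrite expr2 -(addn1 1); exact: mpoly.dhomogM (dhomogXi i) (dhomogXi i).
Qed.

Lemma dhomog_deriv k p i : p \is homog k.+1 -> mpoly.mderiv i p \is homog k.
Proof.
move=> hp; apply/mpoly.dhomogP => m; rewrite mpoly.mcoeff_msupp mpoly.mcoeff_deriv => H.
have : mpoly.mcoeff (mpoly.mnm_add m (mpoly.mnm1 i)) p != 0.
  by apply: contraNneq H => ->; rewrite mul0rn.
rewrite -mpoly.mcoeff_msupp => /(dhomog_mdeg hp).
by rewrite mpoly.mdegD mpoly.mdeg1 addn1 => -[<-].
Qed.

Lemma dhomog0_deriv p i : p \is homog 0 -> mpoly.mderiv i p = 0.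
Proof.
move=> hp; apply/mpoly.mpolyP => m; rewrite mpoly.mcoeff_deriv mpoly.mcoeff0.
rewrite (mpoly.dhomog_nemf_coeff hp) ?mul0rn//.
have E : mpoly.mdeg (mpoly.mnm_add m (mpoly.mnm1 i)) = (mpoly.mdeg m).+1.
  by rewrite mpoly.mdegD mpoly.mdeg1 addn1.
by apply/eqP => E0; have := etrans (esym E) E0.
Qed.

(** Euler's identity, monomial by monomial: x_i d_i multiplies x^m by m_i, and the m_i add up to
    k. *)
Lemma euler_homog k p : p \is homog k ->
  \sum_(i < n) X i * mpoly.mderiv i p = k%:R *: p.
Proof.
move=> hp; rewrite {2}(mpoly.mpolyE p).
under eq_bigr do rewrite {1}(mpoly.mpolyE p) linear_sum mulr_sumr.
rewrite exchange_big/= scaler_sumr; apply: eq_big_seq => m /(dhomog_mdeg hp) <-.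
under eq_bigr do rewrite mpoly.mderivZ mpoly.mderivX -!scalerAr scalerA.
rewrite mpoly.mdegE natr_sum scaler_suml; apply: eq_bigr => i _.
(* Exponents are lowered by truncated subtraction, so multiplying by x_i restores x^m only if m_i >
   0. *)
rewrite scalerA [in RHS]mulrC; have [->|mi0] := eqVneq (m i) 0%N.
  by rewrite mulr0 !scale0r.
rewrite -mpoly.mpolyXD; congr (_ *: mpoly.mpolyX R _).
apply/mpoly.mnmP => j; rewrite mpoly.mnmDE mpoly.mnmBE mpoly.mnm1E.
by case: eqP => [<-|_]; rewrite ?subnKC ?lt0n// subn0.
Qed.

End homogeneous.

Section sphere_integrals.
Variables (R : realType) (m : nat).
Local Notation MP := (mpoly.mpoly m.+1 R).
Local Notation homog k := (mpoly.ishomog1 k (@mpoly.mdeg m.+1)).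
Local Notation X i := (mpoly.mpolyX R (mpoly.mnm1 i)).
Local Notation surf := (@surface R m).
Local Notation mu := (@tuple_measure _ _ R (@lebesgue_measure R) m.+1).
Implicit Types p q : MP.

Definition sint p : R := \int[surf]_y sphere_poly p y.

Lemma measurable_sphere_poly p : measurable_fun setT (sphere_poly p).
Proof. exact: (measurableT_comp (measurable_peval p) (@measurable_sval R m)). Qed.

Lemma sphere_poly_bounded p : exists M, forall y, `|sphere_poly p y| <= M.
Proof.
have [M pM] := peval_bounded p; exists M => y.
by apply: pM; rewrite sqn_sphere.
Qed.

Lemma integrable_sphere_poly p : surf.-integrable setT (EFin \o sphere_poly p).
Proof.
have [M pM] := sphere_poly_bounded p.
apply: (@bounded_integrable _ _ _ _ _ _ M) => //; first exact: surface_fin.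
exact: measurable_sphere_poly.
Qed.

Lemma sphere_polyD p q y : sphere_poly (p + q) y = sphere_poly p y + sphere_poly q y.
Proof. exact: mpoly.mevalD. Qed.

Lemma sphere_polyM p q y : sphere_poly (p * q) y = sphere_poly p y * sphere_poly q y.
Proof. exact: mpoly.mevalM. Qed.

Lemma sphere_polyZ c p y : sphere_poly (c *: p) y = c * sphere_poly p y.
Proof. exact: mpoly.mevalZ. Qed.

Lemma sphere_poly_sqn y : sphere_poly (psqn R m.+1) y = 1.
Proof. by rewrite -(sqn_sphere y) -peval_sqn. Qed.

Lemma sintD p q : sint (p + q) = sint p + sint q.
Proof.
rewrite /sint -RintegralD//; try exact: integrable_sphere_poly.
by apply: eq_Rintegral => y _; rewrite sphere_polyD.
Qed.

Lemma sintZ c p : sint (c *: p) = c * sint p.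
Proof.
rewrite /sint -RintegralZl//; try exact: integrable_sphere_poly.
by apply: eq_Rintegral => y _; rewrite sphere_polyZ.
Qed.

Lemma sint0 : sint 0 = 0.
Proof. by rewrite -(scale0r 0) sintZ mul0r. Qed.

Lemma sint_sum I (r : seq I) (F : I -> MP) :
  sint (\sum_(i <- r) F i) = \sum_(i <- r) sint (F i).
Proof. exact: (big_morph sint sintD sint0). Qed.

Lemma sint_sqn p : sint (p * psqn R m.+1) = sint p.
Proof. by apply: eq_Rintegral => y _; rewrite sphere_polyM sphere_poly_sqn mulr1. Qed.

Definition bint p : R := \int[mu]_(x in pball m.+1 1) peval p x.

Lemma bintD p q : bint (p + q) = bint p + bint q.
Proof.
rewrite /bint -RintegralD//; try exact: integrable_pball; last exact: measurable_pball.
by apply: eq_Rintegral => x _; rewrite /peval mpoly.mevalD.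
Qed.

Lemma bintZ c p : bint (c *: p) = c * bint p.
Proof.
rewrite /bint -RintegralZl//; try exact: integrable_pball; last exact: measurable_pball.
by apply: eq_Rintegral => x _; rewrite /peval mpoly.mevalZ.
Qed.

Lemma sint_homog k p : p \is homog k -> sint p = (m.+1 + k)%:R * bint p.
Proof.
move=> hp; have [M pM] := peval_bounded p.
apply: (@polar_integral R m k (peval p) M) => //; first exact: measurable_peval.
by move=> t x _; exact: peval_homog.
Qed.

(** The ball integral of d_i p - |x|^2 d_i p - 2 x_i p is 0. Converting each term to a sphere
    integral, where |x| = 1, gives S / (m + k) - S / (m + k + 2) = 2 T / (m + k + 2), with S and T
    the sphere integrals of d_i p and x_i p; hence S = (m + k) T. *)
Lemma sint_deriv k p i : p \is homog k ->
  sint (mpoly.mderiv i p) = (m + k)%:R * sint (X i * p).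
Proof.
move=> hp; have := Rintegral_deriv_ball p i; rewrite -/(bint _).
have dX2 : mpoly.mderiv i (psqn R m.+1) = 2 *: X i.
  rewrite /psqn linear_sum (bigD1 i)//= big1 ?addr0.
    rewrite expr2 mpoly.mderivM mpoly.mderivX mpoly.mnm1E eqxx scale1r.
    have -> : mpoly.mnm_sub (mpoly.mnm1 i) (mpoly.mnm1 i) = mpoly.mnm0.
      by apply/mpoly.mnmP => j; rewrite mpoly.mnmBE subnn mpoly.mnm0E.
    by rewrite mpoly.mpolyX0 mul1r mulr1 scaler_nat mulr2n.
  move=> j /negPf ji; rewrite expr2 mpoly.mderivM mpoly.mderivX mpoly.mnm1E ji.
  by rewrite scale0r mul0r mulr0 addr0.
have -> : mpoly.mderiv i (p * (1 - psqn R m.+1)) =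
    mpoly.mderiv i p + (-1) *: (mpoly.mderiv i p * psqn R m.+1) + (-2) *: (X i * p).
  rewrite mpoly.mderivM linearB/= dX2 (_ : mpoly.mderiv i 1 = 0); last exact: mpoly.mderivC.
  by rewrite sub0r mulrBr mulr1 !scaleNr scale1r mulrN -scalerAr [p * _]mulrC.
rewrite !bintD !bintZ.
have hX : X i * p \is homog k.+1.
  exact: mpoly.dhomogM (dhomogXi _ i) hp.
(* In degree 0 the derivative vanishes, and the identity forces the ball integral of x_i p to be
   0. *)
case: k hp hX => [|k] hp hX.
  rewrite (dhomog0_deriv i hp) mul0r (sint_homog hX) -(scale0r 0) bintZ sintZ !mul0r.
  by rewrite mulr0 !add0r => /eqP; rewrite mulf_eq0 oppr_eq0 pnatr_eq0/= => /eqP ->; rewrite !mulr0.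
have hd := dhomog_deriv i hp.
have hds := mpoly.dhomogM hd (dhomog_sqn R m.+1).
have := sint_homog hds; rewrite sint_sqn => Eds.
have := sint_homog hd => Ed; have := sint_homog hX => EX.
have c1 : (m.+1 + k)%:R != 0 :> R by rewrite pnatr_eq0.
have c2 : (m.+1 + (k + 2))%:R != 0 :> R by rewrite pnatr_eq0.
move: Ed Eds EX; rewrite -(addn2 k) => Ed Eds EX.
set S := sint _ in Ed Eds *; set T := sint _ in EX *.
move: (bint _) (bint _) (bint _) Ed Eds EX => c b a Ed Eds EX H.
have aE : a = S / (m.+1 + k)%:R by rewrite Ed mulrAC divff// mul1r.
have bE : b = S / (m.+1 + (k + 2))%:R by rewrite Eds mulrAC divff// mul1r.
have cE : c = T / (m.+1 + (k + 2))%:R by rewrite EX mulrAC divff// mul1r.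
move: H; rewrite aE bE cE => /(congr1 (fun z => z * ((m.+1 + k)%:R * (m.+1 + (k + 2))%:R))).
rewrite mul0r => H.
have H2 : S * (m.+1 + (k + 2))%:R - S * (m.+1 + k)%:R - 2 * T * (m.+1 + k)%:R = 0.
  rewrite -[RHS]H; move: c1 c2 => {H aE bE cE Ed Eds EX hds hd hX}.
  move: (m.+1 + k)%:R (m.+1 + (k + 2))%:R => u v u0 v0.
  by field; rewrite u0 v0.
have -> : (m + k.+1)%:R = (m.+1 + k)%:R :> R by rewrite addSnnS.
apply: (@mulfI _ 2); first by rewrite pnatr_eq0.
apply/eqP; rewrite -subr_eq0; apply/eqP; rewrite -[RHS]H2.
by rewrite [(m.+1 + (k + 2))%N]addnA natrD; ring.
Qed.

(** The predecessor is the degree of h d_i g; for l = 0 both sides vanish. *)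
Lemma sint_grad k l h g : h \is homog k -> g \is homog l -> laplacian g = 0 ->
  sint (\sum_(i < m.+1) mpoly.mderiv i h * mpoly.mderiv i g) =
  (m + (k + l).-1)%:R * l%:R * sint (h * g).
Proof.
move=> hh hg Lg.
have -> : \sum_(i < m.+1) mpoly.mderiv i h * mpoly.mderiv i g =
    \sum_(i < m.+1) mpoly.mderiv i (h * mpoly.mderiv i g).
  under [RHS]eq_bigr do rewrite mpoly.mderivM.
  by rewrite big_split/= -mulr_sumr -/(laplacian g) Lg mulr0 addr0.
case: l hg => [|l] hg.
  rewrite big1 ?sint0 ?mulr0 ?mul0r// => i _.
  by rewrite (dhomog0_deriv i hg) mulr0 linear0.
rewrite addnS/= sint_sum.
under eq_bigr => i _ do
  rewrite (sint_deriv i (mpoly.dhomogM hh (dhomog_deriv i hg))) mulrCA.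
rewrite -mulr_sumr -sint_sum -mulr_sumr (euler_homog hg) -scalerAr sintZ.
by rewrite mulrA.
Qed.

(** Subtracting the two evaluations of [sint_grad] leaves the factor m + (k + l).-1, nonzero because
    m > 0, times l - k. *)
Lemma sint_harmonic_orthogonal k l h g : (0 < m)%N -> k != l ->
  h \is homog k -> g \is homog l -> laplacian h = 0 -> laplacian g = 0 ->
  sint (h * g) = 0.
Proof.
move=> m0 kl hh hg Lh Lg.
have := sint_grad hh hg Lg; under eq_bigr do rewrite mulrC.
rewrite (sint_grad hg hh Lh) (addnC l) (mulrC g) => /eqP.
rewrite -subr_eq0 -mulrBl -mulrBr !mulf_eq0 pnatr_eq0 addn_eq0 (gtn_eqF m0)/=.
by rewrite subr_eq0 eqr_nat (negPf kl) => /eqP.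
Qed.

End sphere_integrals.

(** * Dimension counts *)

(** If N > q, the N x q coefficient matrix has a nonzero left kernel vector, which is a linear
    relation between the g i. *)
Lemma indep_card (R : fieldType) (T : Type) N q (g : 'I_N -> T -> R) (b : 'I_q -> T -> R)
    (A : 'I_N -> 'I_q -> R) :
  (forall i x, g i x = \sum_j A i j * b j x) ->
  (forall c : 'I_N -> R, (forall x, \sum_i c i * g i x = 0) -> forall i, c i = 0) ->
  (N <= q)%N.
Proof.
move=> gE indep; rewrite leqNgt; apply/negP => qN.
pose M := \matrix_(i, j) A i j.
have : kermx M != 0.
  rewrite kermx_eq0 /row_free neq_ltn; apply/orP; left.
  by apply: leq_ltn_trans qN; exact: rank_leq_col.
move=> /rowV0Pn[c /sub_kermxP cM c0]; case/negP: c0; apply/eqP/rowP => i; rewrite mxE.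
apply: indep => x; under eq_bigr do rewrite gE mulr_sumr.
rewrite exchange_big/= big1// => j _.
have /rowP/(_ j) := cM; rewrite !mxE => E.
rewrite -[RHS](mul0r (b j x)) -[X in _ = X * _]E mulr_suml.
by apply: eq_bigr => k _; rewrite mxE mulrA.
Qed.

Lemma dimf_le (R : realType) (T : Type) (V : set (T -> R)) q (b : 'I_q -> T -> R) :
  (forall f, V f -> exists c : 'I_q -> R, forall x, f x = \sum_i c i * b i x) ->
  (dimf V <= q)%N.
Proof.
move=> spanV; rewrite /dimf.
(* Without a finite basis [dimf] is 0 and the bound is trivial. *)
case: xgetP => [N _ [g [gV indep _]]|]; last by [].
have /choice[A AE] : forall i, exists c : 'I_q -> R, forall x, g i x = \sum_j c j * b j x.
  by move=> i; exact: spanV.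
exact: indep_card AE indep.
Qed.

Section counting.
Variables (R : realType) (m : nat).
Local Notation MP := (mpoly.mpoly m.+1 R).
Local Notation homog k := (mpoly.ishomog1 k (@mpoly.mdeg m.+1)).
Implicit Types p q : MP.

(* the library only has a local notation for this list of monomials *)
Definition mnm_basis k := [seq mpoly.s2m (val t) | t in mpoly.basis m.+1 k].
Local Notation B := mnm_basis.

(** The number of monomials of degree k in m + 1 variables. *)
Definition hdim k := 'C(k + m, k).

(** Monomials of degree k - 1: there are none for k = 0, whereas [hdim k.-1] would be 1. *)
Definition hdim_pred k := if k is k'.+1 then hdim k' else 0%N.

Lemma hdim_predE k : (0 < k)%N -> hdim_pred k = hdim k.-1.
Proof. by case: k. Qed.

(* On the sphere |x|^2 = 1, so multiplying monomials by powers of |x|^2 shows that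
   Pi k is spanned by the monomials of degrees k and k - 1. *)
Definition qdim k := (hdim k + hdim_pred k)%N.

Lemma homog_basisE k p : p \is homog k ->
  p = \sum_(u <- B k) mpoly.mcoeff u p *: mpoly.mpolyX R u.
Proof.
move=> hp; apply/mpoly.mpolyP => v; rewrite raddf_sum/=.
under eq_bigr do rewrite mpoly.mcoeffZ mpoly.mcoeffX.
have [vB|vB] := boolP (v \in B k).
  rewrite (bigD1_seq v)//= ?mpoly.uniq_basis// eqxx mulr1 big1 ?addr0// => u.
  by move=> /negPf ->; rewrite mulr0.
rewrite big_seq big1 => [|u uB].
  by rewrite (mpoly.dhomog_nemf_coeff hp)// mpoly.basis_cover.
by rewrite (_ : u == v = false) ?mulr0//; apply: contraNF vB => /eqP <-.
Qed.

Lemma homog_mnm k j : j \in B k -> mpoly.mpolyX R j \is homog k.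
Proof. by rewrite -mpoly.basis_cover mpoly.dhomogX. Qed.

(** Induction on the degree: the partial derivatives also vanish everywhere, hence are 0, and
    Euler's identity then gives k p = 0. *)
Lemma peval_eq0 k p : p \is homog k -> (forall x, peval p x = 0) -> p = 0.
Proof.
elim: k p => [|k IH] p hp p0.
  have pE : p = mpoly.mpolyC m.+1 (mpoly.mcoeff mpoly.mnm0 p).
    apply/mpoly.mpolyP => u; rewrite mpoly.mcoeffC.
    have [->|u0] := eqVneq u mpoly.mnm0; first by rewrite mulr1.
    by rewrite mulr0 (mpoly.dhomog_nemf_coeff hp)// mpoly.mdeg_eq0.
  have := p0 [tuple of nseq m.+1 0]; rewrite pE /peval mpoly.mevalC => ->.
  by rewrite mpoly.mpolyC0.
have d0 i : mpoly.mderiv i p = 0.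
  apply: IH => [|x]; first exact: dhomog_deriv.
  have <- : upd x i (tnth x i) = x.
    by apply/eq_from_tnth => j; rewrite tnth_mktuple; case: eqP => [->|].
  rewrite peval_upd pslice_deriv derivE.
  rewrite (_ : horner _ = cst 0) ?derive1_cst//.
  by apply/funext => u; rewrite -peval_upd p0.
have := euler_homog hp; rewrite big1 => [/esym/eqP|i _]; last by rewrite d0 mulr0.
by rewrite scaler_eq0 pnatr_eq0/= => /eqP.
Qed.

Lemma sphere_poly_eq0 k p : p \is homog k -> (forall y, sphere_poly p y = 0) -> p = 0.
Proof.
move=> hp p0; apply: peval_eq0 (hp) _ => x.
have -> : x = scale_tuple (Num.sqrt (sqn x)) (sval (radial x)).
  have := sqn_ge0 x; rewrite le_eqVlt => /predU1P[x0|x0].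
    rewrite -x0 sqrtr0; apply/eq_from_tnth => i; rewrite tnth_mktuple mul0r.
    by apply/eqP; rewrite -sqrf_eq0 eq_le sqr_ge0 andbT x0 tnth_sqn.
  rewrite sval_radial//; apply/eq_from_tnth => i; rewrite !tnth_mktuple mulVKf//.
  by rewrite gt_eqF// sqrtr_gt0.
by rewrite (peval_homog _ _ hp) [X in _ * X](p0 (radial x)) mulr0.
Qed.

Lemma laplacian_homog k p : p \is homog k.+2 -> laplacian p \is homog k.
Proof. by move=> hp; apply: rpred_sum => i _; do 2!apply: dhomog_deriv. Qed.

Lemma laplacian_small k p : (k <= 1)%N -> p \is homog k -> laplacian p = 0.
Proof.
case: k => [|[|//]] _ hp; apply: big1 => i _.
  by rewrite (dhomog0_deriv i hp) linear0.
exact/dhomog0_deriv/dhomog_deriv.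
Qed.

(** The monomials of degree k - 2, in which the Laplacian of a form of degree k is expanded. *)
Definition laplacian_basis k := if k is k'.+2 then B k' else [::].

Lemma size_laplacian_basis k : size (laplacian_basis k.+1) = hdim_pred k.
Proof. by case: k => [//|k]; rewrite /= mpoly.size_basis. Qed.

Lemma laplacian_eq0 k p : p \is homog k ->
  (forall u, u \in laplacian_basis k -> mpoly.mcoeff u (laplacian p) = 0) -> laplacian p = 0.
Proof.
move: k => [|[|k]] hp H; [exact: (@laplacian_small 0)|exact: (@laplacian_small 1)|].
rewrite (homog_basisE (laplacian_homog hp)) big_seq big1// => u uB.
by rewrite H ?scale0r.
Qed.

Lemma laplacianD p q : laplacian (p + q) = laplacian p + laplacian q.
Proof. by rewrite /laplacian -big_split; apply: eq_bigr => i _; rewrite !linearD. Qed.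

Lemma laplacianZ c p : laplacian (c *: p) = c *: laplacian p.
Proof. by rewrite /laplacian scaler_sumr; apply: eq_bigr => i _; rewrite !linearZ. Qed.

Lemma laplacian_sum I (r : seq I) (F : I -> MP) :
  laplacian (\sum_(i <- r) F i) = \sum_(i <- r) laplacian (F i).
Proof.
apply: (big_morph (@laplacian R m) laplacianD).
by rewrite /laplacian big1// => i _; rewrite !linear0.
Qed.

Lemma dimf_Pi k : (dimf (@Pi R m k) <= qdim k)%N.
Proof.
pose b (i : 'I_(qdim k)) : sphere R m -> R :=
  match fintype.split i with
  | inl i => sphere_poly (mpoly.mpolyX R (nth mpoly.mnm0 (B k) i))
  | inr i => sphere_poly (mpoly.mpolyX R (nth mpoly.mnm0 (B k.-1) i))
  end.
apply: (dimf_le (b := b)) => f [p /= pk <-].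
pose S := psqn R m.+1.
pose e (u : mpoly.multinom m.+1) := (k - mpoly.mdeg u)%N.
(* Powers of |x|^2, equal to 1 on the sphere, raise each monomial to degree k or k - 1 according to
   parity. *)
pose F u := mpoly.mcoeff u p *: (mpoly.mpolyX R u * S ^+ (e u)./2).
pose p1 := \sum_(u <- mpoly.msupp p | ~~ odd (e u)) F u.
pose p2 := \sum_(u <- mpoly.msupp p | odd (e u)) F u.
have degp u : u \in mpoly.msupp p -> (mpoly.mdeg u <= k)%N.
  by move=> /mpoly.msize_mdeg_lt /leq_trans /(_ pk).
have hF u : mpoly.mpolyX R u * S ^+ (e u)./2 \is homog (mpoly.mdeg u + (e u)./2.*2)%N.
  rewrite -mul2n; apply: mpoly.dhomogM; first by rewrite mpoly.dhomogX.
  exact: mpoly.dhomogMn (dhomog_sqn R m.+1).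
have pE y : sphere_poly p y = sphere_poly p1 y + sphere_poly p2 y.
  rewrite -sphere_polyD addrC.
  have -> : p2 + p1 = \sum_(u <- mpoly.msupp p) F u by rewrite [RHS](bigID (fun u => odd (e u))).
  rewrite {1}(mpoly.mpolyE p) /sphere_poly !raddf_sum; apply: eq_bigr => u _ /=.
  rewrite !mpoly.mevalZ mpoly.mevalM; congr (_ * _).
  rewrite -[LHS]mulr1; congr (_ * _).
  rewrite rmorphXn/= (_ : mpoly.meval _ S = 1) ?expr1n//.
  exact: sphere_poly_sqn.
have h1 : p1 \is homog k.
  rewrite /p1 big_seq_cond; apply: rpred_sum => u /andP[uB ou].
  apply: rpredZ; have := hF u.
  by rewrite even_halfK// /e subnKC// degp.
have h2 : k = 0%N -> p2 = 0.
  move=> k0; rewrite /p2 big_pred0// => u; by rewrite /e k0 sub0n.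
have h2' : (0 < k)%N -> p2 \is homog k.-1.
  move=> k0; rewrite /p2 big_seq_cond; apply: rpred_sum => u /andP[uB ou].
  apply: rpredZ; have := hF u.
  rewrite odd_halfK// /e; congr (_ \is homog _).
  by have := degp u uB; have : (0 < e u)%N by [case: (e u) ou]; rewrite /e; lia.
exists (fun i => match fintype.split i with
  | inl i => mpoly.mcoeff (nth mpoly.mnm0 (B k) i) p1
  | inr i => mpoly.mcoeff (nth mpoly.mnm0 (B k.-1) i) p2 end) => y.
rewrite big_split_ord/= pE; congr (_ + _).
  rewrite {1}(homog_basisE h1) /sphere_poly raddf_sum (big_nth mpoly.mnm0) big_mkord.
  rewrite mpoly.size_basis; apply: eq_bigr => i _.
  by rewrite /b (unsplitK (inl i)) /= mpoly.mevalZ.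
case: (posnP k) => [k0|k0].
  rewrite (h2 k0) big1 ?/sphere_poly ?raddf0// => i _.
  by rewrite (unsplitK (inr i))/= mpoly.mcoeff0 mul0r.
have hk := hdim_predE k0.
rewrite {1}(homog_basisE (h2' k0)) /sphere_poly raddf_sum (big_nth mpoly.mnm0) big_mkord.
rewrite mpoly.size_basis -/(hdim _) -hk; apply: eq_bigr => i _.
by rewrite /b (unsplitK (inr i)) /= mpoly.mevalZ.
Qed.

(* rank-nullity for the Laplacian, from degree k to degree k - 2 *)
Lemma dimf_Harm_ge k (b : 'I_(dimf (@Harm R m k)) -> sphere R m -> R) :
  is_basis (@Harm R m k) b -> (hdim k <= dimf (@Harm R m k) + size (laplacian_basis k))%N.
Proof.
move=> [_ _ spanH].
pose N := hdim k.
pose Xk (i : 'I_N) : MP := mpoly.mpolyX R (nth mpoly.mnm0 (B k) i).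
pose L : 'M[R]_(N, size (laplacian_basis k)) :=
  \matrix_(i, j) mpoly.mcoeff (nth mpoly.mnm0 (laplacian_basis k) j) (laplacian (Xk i)).
pose P (c : 'rV[R]_N) : MP := \sum_i c 0 i *: Xk i.
have hX i : Xk i \is homog k.
  by apply: homog_mnm; rewrite mem_nth// mpoly.size_basis.
have hP c : P c \is homog k by apply: rpred_sum => i _; exact: rpredZ.
have LP c : c *m L = 0 -> laplacian (P c) = 0.
  move=> cL; apply: (laplacian_eq0 (hP c)) => u /(nthP mpoly.mnm0)[j jB <-].
  have /rowP/(_ (Ordinal jB)) := cL; rewrite !mxE => E.
  rewrite /P laplacian_sum raddf_sum -[RHS]E; apply: eq_bigr => i _.
  by rewrite /= laplacianZ mpoly.mcoeffZ mxE.
have P_inj c : P c = 0 -> c = 0.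
  move=> Pc; apply/rowP => i; rewrite mxE.
  have := congr1 (mpoly.mcoeff (nth mpoly.mnm0 (B k) i)) Pc.
  rewrite mpoly.mcoeff0 /P raddf_sum (bigD1 i)//= big1 => [|j ji].
    by rewrite addr0 mpoly.mcoeffZ mpoly.mcoeffX eqxx mulr1.
  rewrite mpoly.mcoeffZ mpoly.mcoeffX nth_uniq ?mpoly.size_basis ?mpoly.uniq_basis//.
  by rewrite (inj_eq val_inj) (negPf ji) mulr0.
(* The rows of [K] are coefficient vectors of harmonic forms; they stay independent as functions on
   the sphere, since a form vanishing there is 0. *)
pose K := row_base (kermx L).
have KL i : row i K *m L = 0.
  by apply/sub_kermxP; rewrite -(eq_row_base (kermx L)) row_sub.
have /choice[A AE] : forall i, exists c : 'I_(dimf (@Harm R m k)) -> R,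
    forall y, sphere_poly (P (row i K)) y = \sum_j c j * b j y.
  by move=> i; apply: spanH; exists (P (row i K)) => //; split; [exact: hP|exact/LP].
have : (\rank (kermx L) <= dimf (@Harm R m k))%N.
  apply: (indep_card AE) => c c0 i.
  pose cv := \row_i c i.
  have PcE : P (cv *m K) = \sum_i c i *: P (row i K).
    rewrite /P; under [RHS]eq_bigr do rewrite scaler_sumr.
    rewrite exchange_big; apply: eq_bigr => j _; rewrite mxE scaler_suml.
    by apply: eq_bigr => l _; rewrite !mxE scalerA.
  have : cv *m K = 0.
    apply: P_inj; apply: (sphere_poly_eq0 (hP _)) => y.
    rewrite PcE /sphere_poly raddf_sum -[RHS](c0 y).
    by apply: eq_bigr => l _ /=; rewrite mpoly.mevalZ.
  move=> /eqP; rewrite mulmx_free_eq0 ?row_base_free// => /eqP/rowP/(_ i).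
  by rewrite !mxE.
by rewrite mxrank_ker; have := rank_leq_col L; rewrite -/N; lia.
Qed.

(** The lower bounds [hdim k] - [hdim (k - 2)] for the harmonic dimensions telescope to the two top
    terms. *)
Lemma qdim_le_sum (Y : @harmonic_family R m) K :
  (forall k, is_basis (@Harm R m k) (Y k)) ->
  (qdim K <= \sum_(k < K.+1) dimf (@Harm R m k))%N.
Proof.
move=> hY; elim: K => [|K IH].
  by rewrite big_ord1 /qdim addn0; have := dimf_Harm_ge (hY 0%N); rewrite addn0.
rewrite big_ord_recr/= /qdim/=.
move: IH (dimf_Harm_ge (hY K.+1)); rewrite size_laplacian_basis /qdim.
move: (\sum_(i < K.+1) _)%N (dimf _) (hdim _) (hdim _) (hdim_pred _).
by move=> u v w y z; lia.
Qed.

(** Bounded growth per degree keeps the least degree with enough harmonics from overshooting. It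
    follows from (K + 1) C(K + 1 + m, K + 1) = (K + 1 + m) C(K + m, K). *)
Lemma qdimS K : (qdim K.+1 <= m.+2 * qdim K)%N.
Proof.
have : (hdim K.+1 <= m.+1 * hdim K)%N.
  rewrite -(leq_pmul2l (ltn0Sn K)) /hdim.
  have := mul_bin_diag (K + m).+1 K; rewrite /= addSn => <-; nia.
by rewrite /qdim /=; nia.
Qed.

Lemma qdim_ge K : (0 < m)%N -> (K < qdim K)%N.
Proof.
move=> m0; apply: leq_trans (leq_addr _ _).
by rewrite /hdim -{1}(binSn K) leq_bin2l// -addn1 leq_add2l.
Qed.

End counting.

(** * Hamming balls *)

Section hamming.
Variables (I : finType).
Implicit Types s t : {ffun I -> bool}.

Definition hamming s t := #|[pred i | s i != t i]|.

(** The sum over sign vectors factors over coordinates: agreement contributes 1, disagreement x. *)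
Lemma hamming_enumerator (R : realFieldType) s (x : R) :
  \sum_t x ^+ hamming s t = (1 + x) ^+ #|I|.
Proof.
have E t : x ^+ hamming s t = \prod_i (if s i != t i then x else 1).
  by rewrite -big_mkcond/= prodr_const.
under eq_bigr do rewrite E.
rewrite -(bigA_distr_bigA (fun i b => if s i != b then x else 1)).
rewrite (eq_bigr (fun => 1 + x)) ?prodr_const// => i _.
by rewrite big_bool; case: (s i) => /=; rewrite // addrC.
Qed.

(** A Chernoff bound: A lies in a ball of radius M / 4 about any of its points, so each of its
    elements weighs at least (1/4)^(M/4) in the enumerator at 1/4, whose value is (5/4)^M. Fourth
    powers avoid fractional exponents. *)
Lemma hamming_small_card (R : realFieldType) (A : {set {ffun I -> bool}}) :
  (forall s t, s \in A -> t \in A -> (4 * hamming s t <= #|I|)%N) ->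
  #|A|%:R ^+ 4 <= ((5 / 4) ^+ 4 * 4) ^+ #|I| :> R.
Proof.
move=> hA; have c0 : 0 <= 5 / 4 :> R by lra.
have b0 : 0 <= (5 / 4) ^+ 4 * 4 :> R by rewrite mulr_ge0// exprn_ge0.
have [->|[s sA]] := set_0Vmem A.
  by rewrite cards0 [X in X <= _]expr0n exprn_ge0.
set M := #|I|; pose h := (M %/ 4)%N.
have hM : (h * 4 <= M)%N by exact: leq_trunc_div.
have H : #|A|%:R * (1 / 4) ^+ h <= (5 / 4) ^+ M :> R.
  have -> : (5 / 4) ^+ M = \sum_t (1 / 4) ^+ hamming s t :> R.
    by rewrite hamming_enumerator; congr (_ ^+ _); lra.
  rewrite (bigID (mem A))/= -[leLHS]addr0; apply: lerD; last first.
    by apply: sumr_ge0 => t _; rewrite exprn_ge0.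
  rewrite mulr_natl -sumr_const; apply: ler_sum => t tA.
  rewrite ler_wiXn2l//; [lra|].
  by rewrite /h leq_divRL// mulnC hA.
have H4 : #|A|%:R ^+ 4 * (1 / 4) ^+ (h * 4) <= ((5 / 4) ^+ 4) ^+ M :> R.
  rewrite exprM -exprMn -exprM (mulnC 4%N) exprM.
  by apply: lerXn2r => //; rewrite nnegrE ?mulr_ge0// ?exprn_ge0.
rewrite exprMn; have p4 : 0 <= 4 ^+ M :> R by rewrite exprn_ge0.
apply: le_trans (ler_wpM2r p4 H4).
rewrite -mulrA ler_peMr ?exprn_ge0//.
rewrite div1r exprVn ler_pdivlMl ?exprn_gt0// mulr1 ler_weXn2l//.
by rewrite ler1n.
Qed.

(* the constant 6 comes from 16 < (8 / 5) ^+ 6 *)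
Lemma exists_uncovered (R : realFieldType) (l : nat)
    (A : l.-tuple bool -> {set {ffun I -> bool}}) :
  (0 < l)%N -> (6 * l <= #|I|)%N ->
  (forall b s t, s \in A b -> t \in A b -> (4 * hamming s t <= #|I|)%N) ->
  exists s, forall b, s \notin A b.
Proof.
move=> l0 lM hA; set M := #|I|.
suff /existsP[s /forallP sA] : [exists s, forall b, s \notin A b] by exists s.
apply: contraT => /existsPn cover.
have : (#|{: {ffun I -> bool}}| <= \sum_b #|A b|)%N.
  rewrite -sum1_card; under [leqRHS]eq_bigr do rewrite -sum1_card big_mkcond.
  rewrite exchange_big; apply: leq_sum => s _.
  have /forallPn[b] := cover s; rewrite negbK => sb.
  by rewrite (bigD1 b)//= sb.
have [b0 b0M] : exists b0, forall b, (#|A b| <= #|A b0|)%N.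
  pose b1 : l.-tuple bool := [tuple of nseq l true].
  exists [arg max_(b > b1) #|A b|]%N; case: arg_maxnP => // b _ bM b'.
  exact: bM.
rewrite card_ffun card_bool -/M => H.
have {}H : (2 ^ M <= 2 ^ l * #|A b0|)%N.
  apply: leq_trans H _; apply: (@leq_trans (\sum_(b : l.-tuple bool) #|A b0|)%N).
    by apply: leq_sum => b _; exact: b0M.
  by rewrite sum_nat_const card_tuple card_bool.
have := @hamming_small_card R (A b0) (hA b0); rewrite -/M => H4.
set B := (5 / 4) ^+ 4 * 4 in H4.
have B0 : 0 < B by rewrite mulr_gt0// exprn_gt0//; lra.
(* The product is 15.625; so 16^M <= 16^l B^M would force (8/5)^M <= 16^l. *)
have B16 : B * (8 / 5) <= 2 ^+ 4 by rewrite /B; lra.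
have : (2 ^ M)%:R ^+ 4 <= (2 ^ l)%:R ^+ 4 * B ^+ M :> R.
  have p2 : 0 <= (2 ^ l)%:R ^+ 4 :> R by rewrite exprn_ge0.
  apply: le_trans (ler_wpM2l p2 H4).
  by rewrite -exprMn -natrM lerXn2r// ?nnegrE// ler_nat.
rewrite !natrX -!exprM !(mulnC _ 4%N) !exprM.
have : (B * (8 / 5)) ^+ M <= (2 ^+ 4) ^+ M :> R.
  by rewrite lerXn2r// nnegrE ?exprn_ge0// mulr_ge0 ?ltW//; lra.
move=> /le_trans/[apply]; rewrite exprMn mulrC ler_pM2r ?exprn_gt0//.
move=> H8; suff : (2 ^+ 4) ^+ l < (8 / 5) ^+ M :> R by rewrite ltNge H8.
apply: lt_le_trans (_ : (8 / 5) ^+ (6 * l) <= _); last first.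
  by rewrite ler_weXn2l//; lra.
rewrite exprM.
have h6 : 2 ^+ 4 < (8 / 5) ^+ 6 :> R by lra.
by rewrite ltrXn2r// -?lt0n// nnegrE ltW// exprn_gt0//; lra.
Qed.

End hamming.

(** * Sign combinations of harmonics *)

Section cube.
Variables (R : realType) (m : nat) (Y : @harmonic_family R m).
Hypotheses (m_gt0 : (0 < m)%N) (hY : orthonormal_harmonics Y).
Variable K : nat.

Definition cube_index : finType := {k : 'I_K.+1 & 'I_(dimf (@Harm R m k))}.

Implicit Types u v : cube_index -> R.

(** Matching on [idP] makes the proof of k < K + 1 available to build the ordinal index. *)
Definition cube_coef u : @coefficients R m := fun k j =>
  match @idP (k < K.+1)%N with
  | ReflectT h => u (existT _ (Ordinal h) j)
  | ReflectF _ => 0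
  end.

Definition cube_fun u : sphere R m -> R :=
  fun y => \sum_(p : cube_index) u p * Y (tagged p) y.

Lemma cube_coefE u (k : 'I_K.+1) j : cube_coef u j = u (existT _ k j).
Proof.
case: k j => k hk j; rewrite /cube_coef; case: {-}_ / idP => // h.
by rewrite (bool_irrelevance h hk).
Qed.

Lemma cube_coef_out u k (j : 'I_(dimf (@Harm R m k))) : (K < k)%N -> cube_coef u j = 0.
Proof.
by move=> Kk; rewrite /cube_coef; case: {-}_ / idP => // h; move: Kk; rewrite ltnNge -ltnS h.
Qed.

Lemma card_cube_index : #|cube_index| = (\sum_(k < K.+1) dimf (@Harm R m k))%N.
Proof.
rewrite card_tagged sumnE big_map big_enum/=.
by apply: eq_bigr => k _; rewrite card_ord.
Qed.

Lemma sum_cube_coef (V : nmodType) u n (F : forall k, 'I_(dimf (@Harm R m k)) -> R -> V) :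
  (K < n)%N -> (forall k j, F k j 0 = 0) ->
  \sum_(0 <= k < n) \sum_j F k j (cube_coef u j) =
  \sum_(p : cube_index) F (tag p) (tagged p) (u p).
Proof.
move=> Kn F0; rewrite (big_cat_nat (n := K.+1))//= addrC big_nat big1 ?add0r; last first.
  by move=> k /andP[Kk _]; apply: big1 => j _; rewrite cube_coef_out.
rewrite big_mkord (sig_big_dep _ _ (fun (k : 'I_K.+1) j => F k j (cube_coef u j)))/=.
by apply: eq_bigr => -[k j] _ /=; rewrite cube_coefE.
Qed.

Lemma partial_expansion_cube u n : (K < n)%N ->
  partial_expansion Y (cube_coef u) n = cube_fun u.
Proof.
move=> Kn; apply/funext => y; rewrite /partial_expansion /cube_fun.
rewrite -(big_mkord xpredT (fun k => \sum_j @cube_coef u k j * @Y k j y)).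
by rewrite (sum_cube_coef u (F := fun k j c => c * @Y k j y))// => k j; rewrite mul0r.
Qed.

Lemma wnorm2_cube w u :
  wnorm2 w (cube_coef u) = (\sum_(p : cube_index) u p ^+ 2 / w (tag p))%:E.
Proof.
rewrite /wnorm2; apply: lim_near_cst => //.
exists K.+1 => // n /= Kn; under eq_bigr do rewrite sumEFin.
rewrite sumEFin; congr EFin.
by rewrite (sum_cube_coef u (F := fun k _ c => c ^+ 2 / w k))// => k j; rewrite expr0n mul0r.
Qed.

Lemma normw2_sphere_poly (P : mpoly.mpoly m.+1 R) :
  normw2 (sphere_poly P) = ((fine (surface [set: sphere R m]))^-1 * sint (P * P))%:E.
Proof.
rewrite /normw2 EFinM; congr (_ * _)%E.
rewrite /sint /Rintegral fineK; last exact: (integrable_fin_num _ (integrable_sphere_poly _)).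
by apply: eq_integral => y _; rewrite sphere_polyM expr2.
Qed.

Lemma harmonic_poly : exists H : cube_index -> mpoly.mpoly m.+1 R, forall p,
  [/\ H p \is mpoly.ishomog1 (tag p) (@mpoly.mdeg m.+1), laplacian (H p) = 0 &
      sphere_poly (H p) = Y (tagged p)].
Proof.
suff : forall p : cube_index, exists h : mpoly.mpoly m.+1 R,
  [/\ h \is mpoly.ishomog1 (tag p) (@mpoly.mdeg m.+1), laplacian h = 0 &
      sphere_poly h = Y (tagged p)] by move=> /choice[H HP]; exists H.
move=> [k j] /=; have [[/(_ j)[h [hh lh] hE] _ _] _] := hY k.
by exists h.
Qed.

(** Parseval: distinct degrees are orthogonal by [sint_harmonic_orthogonal], equal degrees by the
    orthonormality of [Y]. *)
Lemma cube_fun_poly u : exists2 P, cube_fun u = sphere_poly P &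
  normw2 (sphere_poly P) = (\sum_p u p ^+ 2)%:E.
Proof.
have [H HP] := harmonic_poly.
exists (\sum_p u p *: H p).
  apply/funext => y; rewrite /cube_fun /sphere_poly raddf_sum; apply: eq_bigr => p _ /=.
  by rewrite mpoly.mevalZ; have [_ _ <-] := HP p.
rewrite normw2_sphere_poly; congr EFin.
have orth p q : (fine (surface [set: sphere R m]))^-1 * sint (H p * H q) = (p == q)%:R.
  have [hp lp Ep] := HP p; have [hq lq Eq] := HP q.
  have [pq|pq] := eqVneq (tag p) (tag q); last first.
    rewrite (sint_harmonic_orthogonal m_gt0 _ hp hq)// mulr0.
    by case: eqP => // pq'; rewrite pq' eqxx in pq.
  have -> : sint (H p * H q) = \int[@surface R m]_y (Y (tagged p) y * Y (tagged q) y).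
    by apply: eq_Rintegral => y _; rewrite sphere_polyM Ep Eq.
  move: p q pq {hp lp Ep hq lq Eq} => [k i] [k' j] /= kk'; rewrite -kk' in j *.
  transitivity ((i == j)%:R : R); first exact: (hY k).2.
  congr (nat_of_bool _)%:R; apply/eqP/eqP => [->//|].
  (* [tagged_as] projects an equality of dependent pairs with the same tag to their second
     components. *)
  pose T_ (k : 'I_K.+1) := 'I_(dimf (@Harm R m k)).
  move=> /(congr1 (tagged_as (Tagged T_ i))).
  by rewrite -[X in tagged_as _ X]/(Tagged T_ i) -[X in _ = tagged_as _ X]/(Tagged T_ j) !tagged_asE.
rewrite mulr_suml sint_sum mulr_sumr; apply: eq_bigr => p _.
rewrite mulr_sumr sint_sum mulr_sumr (bigD1 p)//= big1 ?addr0 => [|q /negPf qp].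
  by rewrite -scalerAl -scalerAr !sintZ mulrCA; rewrite (mulrCA _ (u p)) orth eqxx mulr1 expr2.
by rewrite -scalerAl -scalerAr !sintZ mulrCA; rewrite (mulrCA _ (u q)) orth eq_sym qp !mulr0.
Qed.

Lemma normw2_cube u : normw2 (cube_fun u) = (\sum_p u p ^+ 2)%:E.
Proof. by have [P -> ->] := cube_fun_poly u. Qed.

Lemma measurable_cube_fun u : measurable_fun setT (cube_fun u).
Proof. by have [P -> _] := cube_fun_poly u; exact: measurable_sphere_poly. Qed.

Lemma cube_funB u v : cube_fun u \- cube_fun v = cube_fun (fun p => u p - v p).
Proof.
apply/funext => y; rewrite /cube_fun /= -sumrB; apply: eq_bigr => p _.
by rewrite mulrBl.
Qed.

Lemma HK_ball_cube (a : nat -> R) (Q : R) u : \sum_(p : cube_index) u p ^+ 2 / a (tag p) <= Q ^+ 2 ->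
  HK_ball Y a Q (cube_fun u).
Proof.
move=> uQ; exists (cube_coef u); last by rewrite wnorm2_cube lee_fin.
split; last by rewrite wnorm2_cube ltry.
move=> y; apply: cvg_near_cst; exists K.+1 => // n /= Kn.
by rewrite partial_expansion_cube.
Qed.

Lemma normw2_0 : normw2 (cst 0 : sphere R m -> R) = 0%E.
Proof.
by rewrite /normw2 integral0_eq ?mule0// => y _; rewrite expr0n.
Qed.

Lemma Sobolev_cube (a : nat -> R) (r : R) u : Sobolev Y a r (cube_fun u).
Proof.
split; first exact: measurable_cube_fun.
exists (cube_coef u); split; last by rewrite wnorm2_cube ltry.
apply: cvg_near_cst; exists K.+1 => // n /= Kn.
rewrite partial_expansion_cube// -[RHS]normw2_0; congr normw2.
by apply/funext => y /=; rewrite subrr.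
Qed.

End cube.

(** * Squared distances and averages *)

Section squared_distance.
Variables (R : realType) (m : nat).
Implicit Types f g h : sphere R m -> R.

(** Pointwise, the right side exceeds the left by (2 h - f - g)^2. *)
Lemma normw2_parallelogram f g h :
  measurable_fun setT f -> measurable_fun setT g -> measurable_fun setT h ->
  (normw2 (f \- g)%R <= 2%:E * (normw2 (h \- f)%R + normw2 (h \- g)%R))%E.
Proof.
move=> mf mg mh.
have mS (k : sphere R m -> R) : measurable_fun setT k ->
    measurable_fun setT (fun y => (k y ^+ 2)%:E).
  by move=> mk; apply/measurable_EFinP; exact: measurable_funX.
have mhf := mS _ (measurable_funB mh mf); have mhg := mS _ (measurable_funB mh mg).
rewrite /normw2 -ge0_muleDr; last 2 first.
- by apply: integral_ge0 => y _; rewrite lee_fin sqr_ge0.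
- by apply: integral_ge0 => y _; rewrite lee_fin sqr_ge0.
rewrite muleCA; apply: lee_wpmul2l; first by rewrite lee_fin invr_ge0 fine_ge0.
rewrite -ge0_integralD//; try by move=> y _; rewrite lee_fin sqr_ge0.
rewrite -ge0_integralZl_EFin//; last 2 first.
- by move=> y _; rewrite -EFinD lee_fin addr_ge0// sqr_ge0.
- exact: emeasurable_funD.
apply: ge0_le_integral => //.
- by move=> y _; rewrite lee_fin sqr_ge0.
- exact: mS (measurable_funB mf mg).
- apply: measurable_funeM; exact: emeasurable_funD.
- move=> y _; rewrite -EFinD -EFinM lee_fin /=.
  rewrite -subr_ge0 [X in 0 <= X](_ : _ = ((h y - f y) + (h y - g y)) ^+ 2) ?sqr_ge0//.
  by ring.
Qed.

Lemma measurable_HK_ball (Y : @harmonic_family R m) a Q f :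
  orthonormal_harmonics Y -> HK_ball Y a Q f -> measurable_fun setT f.
Proof.
move=> hY [c [cvf _] _].
apply: (measurable_fun_cvg (h := partial_expansion Y c)) => [n|y _]; last exact: cvf.
apply: measurable_sum => k; apply: measurable_sum => j; apply: measurable_funM => //.
have [[/(_ j)[h _ <-] _ _] _] := hY k; exact: measurable_sphere_poly.
Qed.

End squared_distance.

(** The integral is a supremum over simple functions below f, and the constant c is one of them. *)
Lemma integral_ge_cst d (T : measurableType d) (R : realType)
    (mu : {measure set T -> \bar R}) (f : T -> \bar R) (c : R) :
  0 <= c -> mu setT = 1%E -> (forall x, c%:E <= f x)%E -> (c%:E <= \int[mu]_x f x)%E.
Proof.
move=> c0 mu1 cf.
rewrite ge0_integralE; last by move=> x _; apply: le_trans (cf x); rewrite lee_fin.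
apply: ereal_sup_ubound; exists (cst_nnsfun T (NngNum c0)).
  by move=> x /=; rewrite patch_setT.
have := @sintegral_EFin_cst _ T R mu setT (NngNum c0); rewrite patch_setT/= mu1 mule1.
by [].
Qed.

(** * The minimax bound *)

(** Take the least K with enough harmonics: degree K - 1 has fewer than 6 l, and [qdimS] bounds the
    last step. *)
Lemma exists_degree (m l : nat) : (0 < m)%N -> (0 < l)%N ->
  exists2 K, (6 * l <= qdim m K)%N & forall k, (k <= K)%N -> (qdim m k <= 6 * m.+2 * l)%N.
Proof.
move=> m0 l0; have ex : exists K, (6 * l <= qdim m K)%N.
  by exists (6 * l)%N; exact/ltnW/qdim_ge.
exists (ex_minn ex); case: ex_minnP => K // qK Kmin k.
have small j : (j < K)%N -> (qdim m j < 6 * l)%N.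
  by move=> jK; rewrite ltnNge; apply/negP => /Kmin; rewrite leqNgt jK.
rewrite leq_eqVlt => /predU1P[->|/small]; last by nia.
case: K qK Kmin small => [|K] qK Kmin small; first by rewrite /qdim /hdim bin0/=; nia.
have := small K (ltnSn K); have := qdimS m K; nia.
Qed.

(** The limit handles large k, with [dimf_Pi] passing to [qdim]; the finitely many remaining a_k are
    positive and [qdim] is at least 1. *)
Lemma coefficient_lower_bound (R : realType) (m : nat) (s : R) (a : nat -> R) :
  0 < s -> (forall k, 0 < a k <= 1) ->
  (exists2 L : R, 0 < L &
     a k * (dimf (@Pi R m k))%:R `^ (2 * s) @[k --> \oo] --> L) ->
  exists2 c : R, 0 < c & forall k, c <= a k * (qdim m k)%:R `^ (2 * s).
Proof.
move=> s0 ha [L L0 aL].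
have s20 : 0 <= 2 * s by rewrite mulr_ge0// ltW.
have [N _ HN] : \forall k \near \oo, L / 2 <= a k * (dimf (@Pi R m k))%:R `^ (2 * s).
  by apply: (cvgr_ge _ aL); rewrite ltr_pdivrMr// ltr_pMr// ltr1n.
have [c0 c00 Hc0] : exists2 c0 : R, 0 < c0 & forall k, (k < N)%N -> c0 <= a k.
  elim: N {HN} => [|N [c c_gt0 IH]]; first by exists 1.
  have /andP[aN _] := ha N.
  exists (Num.min c (a N)); first by rewrite lt_min c_gt0.
  move=> k; rewrite ltnS leq_eqVlt => /predU1P[->|/IH kc]; first by rewrite ge_min lexx orbT.
  by rewrite ge_min kc.
exists (Num.min c0 (L / 2)); first by rewrite lt_min c00 divr_gt0.
move=> k; have /andP[ak0 _] := ha k; have [kN|kN] := ltnP k N.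
  rewrite ge_min (le_trans (Hc0 _ kN))//= ler_peMr ?(ltW ak0)//.
  suff : 1 `^ (2 * s) <= (qdim m k)%:R `^ (2 * s) by rewrite powR1.
  rewrite ge0_ler_powR ?nnegrE// ler1n.
  by rewrite /qdim addn_gt0 /hdim bin_gt0 leq_addr.
rewrite ge_min; apply/orP; right; apply: le_trans (HN k kN) _.
by rewrite ler_pM2l// ge0_ler_powR ?nnegrE// ler_nat dimf_Pi.
Qed.

Section minimax.
Variables (R : realType) (m : nat) (Y : @harmonic_family R m).
Hypotheses (m_gt0 : (0 < m)%N) (hY : orthonormal_harmonics Y).
Variables (s Q : R) (a : nat -> R).
Hypotheses (s_gt0 : 0 < s) (Q_gt0 : 0 < Q) (a_gt0 : forall k, 0 < a k <= 1).
Hypothesis a_lim : exists2 L : R, 0 < L &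
  a k * (dimf (@Pi R m k))%:R `^ (2 * s) @[k --> \oo] --> L.

Lemma codebook_separation (r : R) : exists2 c : R, 0 < c &
  forall l (D : l.-tuple bool -> sphere R m -> R), (0 < l)%N ->
    (forall b, HK_ball Y a Q (D b)) ->
    exists2 f, (HK_ball Y a Q `&` Sobolev Y a r) f &
      forall b, ((c * l%:R `^ (- (2 * s)))%:E <= normw2 (D b \- f)%R)%E.
Proof.
have [c0 c00 a_ge] := coefficient_lower_bound s_gt0 a_gt0 a_lim.
have s2 : 0 <= 2 * s by rewrite mulr_ge0// ltW.
pose B : R := (6 * m.+2)%:R.
(* This is e^2 M / 4 = Q^2 alpha / 4 below, with the power of l split off. *)
exists (Q ^+ 2 * (c0 * B `^ (- (2 * s))) / 4).
  by rewrite divr_gt0// !mulr_gt0 ?exprn_gt0// powR_gt0// ltr0n.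
move=> l D l0 DW.
have [K qK q_le] := exists_degree m_gt0 l0.
pose alpha := c0 * (B * l%:R) `^ (- (2 * s)).
have Bl0 : 0 < B * l%:R by rewrite mulr_gt0 ?ltr0n.
have alpha0 : 0 < alpha by rewrite mulr_gt0// powR_gt0.
have alphaE : alpha = c0 * B `^ (- (2 * s)) * l%:R `^ (- (2 * s)).
  by rewrite /alpha powRM ?ler0n// mulrA.
have alpha_le k : (k <= K)%N -> alpha <= a k.
  move=> kK; have /andP[ak0 _] := a_gt0 k.
  rewrite /alpha powRN ler_pdivrMr ?powR_gt0//.
  apply: le_trans (a_ge k) _; rewrite ler_pM2l// ge0_ler_powR ?nnegrE ?(ltW Bl0)//.
  by rewrite /B -natrM ler_nat q_le.
pose I := cube_index R m K.
pose M := #|I|.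
have lM : (6 * l <= M)%N.
  apply: leq_trans qK _; rewrite /M card_cube_index.
  by apply: (@qdim_le_sum R m Y) => k; exact: (hY k).1.
have M0 : 0 < M%:R :> R by rewrite ltr0n; apply: leq_trans lM; rewrite muln_gt0.
(* The amplitude spends the whole budget: M e^2 / alpha = Q^2, where alpha <= a_k for k <= K. *)
pose e := Num.sqrt (Q ^+ 2 * alpha / M%:R).
have e2 : e ^+ 2 = Q ^+ 2 * alpha / M%:R.
  by rewrite sqr_sqrtr// divr_ge0// mulr_ge0 ?sqr_ge0// ltW.
have e20 : 0 < e ^+ 2 by rewrite e2 divr_gt0// mulr_gt0// exprn_gt0.
pose u (t : {ffun I -> bool}) (p : I) : R := if t p then e else - e.
have u2 t p : u t p ^+ 2 = e ^+ 2 by rewrite /u; case: (t p); rewrite ?sqrrN.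
have uball t : HK_ball Y a Q (cube_fun Y (u t)).
  apply: HK_ball_cube => //.
  apply: (@le_trans _ _ (\sum_(p : I) e ^+ 2 / alpha)).
    apply: ler_sum => p _; rewrite u2 ler_pM2l//.
    have /andP[ap0 _] := a_gt0 (tag p).
    by rewrite lef_pV2 ?posrE// alpha_le// -ltnS.
  rewrite sumr_const -/M -mulr_natr e2.
  rewrite [leLHS](_ : _ = Q ^+ 2)//; field.
  by rewrite !gt_eqF.
(* Two sign vectors served by the same codeword give functions at squared distance at most e^2 M, so
   four times their Hamming distance is at most M. *)
pose A b := finset [pred t | (normw2 (D b \- cube_fun Y (u t))%R < (e ^+ 2 * M%:R / 4)%:E)%E].
have [|t tA] := @exists_uncovered I R l A l0 lM.
  move=> b t t'; rewrite !finset.in_set /= => tb t'b.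
  have mD := measurable_HK_ball hY (DW b).
  have mc t0 := measurable_cube_fun m_gt0 hY (u t0).
  have := normw2_parallelogram (mc t) (mc t') mD.
  rewrite cube_funB (normw2_cube m_gt0 hY).
  (* Each disagreement of signs contributes (2 e)^2. *)
  have -> : \sum_(p : I) (u t p - u t' p) ^+ 2 = 4 * e ^+ 2 * (hamming t t')%:R.
    rewrite /hamming -sum1_card natr_sum mulr_sumr [RHS]big_mkcond.
    apply: eq_bigr => p _ /=; rewrite inE /u.
    by case: (t p); case: (t' p) => /=; ring.
  move=> H; have : ((4 * e ^+ 2 * (hamming t t')%:R)%:E <=
      2%:E * ((e ^+ 2 * M%:R / 4)%:E + (e ^+ 2 * M%:R / 4)%:E))%E.
    apply: le_trans H _; apply: lee_wpmul2l; first by rewrite lee_fin.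
    by apply: leeD; exact: ltW.
  rewrite -EFinD -EFinM lee_fin.
  rewrite (_ : 2 * _ = e ^+ 2 * M%:R); last by field.
  rewrite mulrAC mulrC ler_pM2l// -natrM ler_nat.
  by [].
exists (cube_fun Y (u t)); first by split; [exact: uball|exact: Sobolev_cube].
move=> b; have := tA b; rewrite finset.in_set /= -leNgt; congr (_ <= _)%E; congr EFin.
by rewrite e2 alphaE; field; rewrite gt_eqF.
Qed.

(** The separation holds for every code b, hence survives averaging over encoder and sample. The
    target comes from the decoder alone, before the law P f enters. *)
Lemma minimax_lower_bound (r : R) : exists2 c : R, 0 < c &
  forall d (Z : measurableType d) n l (w : R) (G : @sized_estimator R m d Z n l)
    (P : (sphere R m -> R) -> probability Z R),
    (0 < l)%N -> 0 <= w -> sized_estimators (HK_ball Y a Q) G ->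
    exists2 f, (HK_ball Y a Q `&` Sobolev Y a r) f &
      ((w * (c * l%:R `^ (- (2 * s))))%:E <= risk (P f) w G f)%E.
Proof.
have [c c0 Hc] := codebook_separation r.
exists c => // d Z n l w G P l0 w0 GW.
have [f fW Gf] := Hc l G.2 l0 GW; exists f => //.
have C0 : 0 <= w * (c * l%:R `^ (- (2 * s))).
  by rewrite !mulr_ge0// ?ltW// powR_ge0.
rewrite /risk; apply: integral_ge_cst => //; first exact: probability_setT.
move=> z; apply: integral_ge_cst => //; first exact: prob_kernel.
by move=> b; rewrite EFinM lee_wpmul2l// lee_fin.
Qed.

End minimax.

(** If l_n <= dl n^(1 / (2 s (2 r + 1))), the product is at least c dl^(-2 s) n^((2 r - 1) / (2 r +
    1)). The exponent of n is nonnegative since r >= 1/2, and dl may be taken arbitrarily small. *)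
Lemma rate_cvg_pinfty (R : realType) (s r c : R) (l : nat -> nat) :
  0 < s -> 1 / 2 <= r -> 0 < c -> (forall n, (0 < l n)%N) ->
  (fun n => (l n)%:R : R^o) =o_\oo
    (fun n => n%:R `^ (1 / (2 * s * (2 * r + 1))) : R^o) ->
  forall A : R, \forall n \near \oo,
    A <= n%:R `^ (2 * r / (2 * r + 1)) * (c * (l n)%:R `^ (- (2 * s))).
Proof.
move=> s0 hr c0 l0 /eqoP hlo A.
pose A' := Num.max A 1.
have A'0 : 0 < A' by rewrite lt_max ltr01 orbT.
have r1 : 0 < 2 * r + 1 by lra.
(* Chosen so that c dl^(-2 s) = [A']. *)
pose dl := (A' / c) `^ (- (1 / (2 * s))).
have dl0 : 0 < dl by rewrite powR_gt0// divr_gt0.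
near=> n.
have n1 : (0 < n)%N by near: n; exact: nbhs_infty_gt.
have : `|(l n)%:R : R| <= dl * `|n%:R `^ (1 / (2 * s * (2 * r + 1)))|.
  by near: n; exact: hlo.
rewrite ger0_norm// ger0_norm ?powR_ge0// => ln.
have nR : 1 <= n%:R :> R by rewrite ler1n.
have n0 : 0 < n%:R :> R by rewrite ltr0n.
have lR : 0 < (l n)%:R :> R by rewrite ltr0n.
apply: (@le_trans _ _ A'); first by rewrite le_max lexx.
have s2 : 0 < 2 * s by rewrite mulr_gt0.
have low : A' / c * n%:R `^ (- (1 / (2 * r + 1))) <= (l n)%:R `^ (- (2 * s)).
  have -> : A' / c * n%:R `^ (- (1 / (2 * r + 1))) =
      (dl * n%:R `^ (1 / (2 * s * (2 * r + 1)))) `^ (- (2 * s)).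
    rewrite powRM ?powR_ge0// /dl -!powRrM; congr (_ * _).
      have -> : - (1 / (2 * s)) * - (2 * s) = 1 by field; rewrite gt_eqF.
      by rewrite powRr1// divr_ge0// ltW.
    by congr (_ `^ _); field; rewrite !gt_eqF.
  have ub0 : 0 < dl * n%:R `^ (1 / (2 * s * (2 * r + 1))).
    by rewrite mulr_gt0// powR_gt0.
  rewrite !powRN lef_pV2 ?posrE ?powR_gt0//.
  by rewrite ge0_ler_powR ?nnegrE ?(ltW ub0) ?(ltW lR) ?(ltW s2).
apply: (@le_trans _ _ (n%:R `^ (2 * r / (2 * r + 1)) *
    (c * (A' / c * n%:R `^ (- (1 / (2 * r + 1))))))); last first.
  by rewrite ler_wpM2l ?powR_ge0// ler_pM2l.
have -> : n%:R `^ (2 * r / (2 * r + 1)) * (c * (A' / c * n%:R `^ (- (1 / (2 * r + 1))))) =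
    A' * n%:R `^ (2 * r / (2 * r + 1) - 1 / (2 * r + 1)).
  rewrite powRD; last by rewrite (gt_eqF n0) implybT.
  by field; rewrite gt_eqF.
have e0 : 0 <= 2 * r / (2 * r + 1) - 1 / (2 * r + 1).
  by rewrite -mulrBl divr_ge0//; lra.
suff : n%:R `^ 0 <= n%:R `^ (2 * r / (2 * r + 1) - 1 / (2 * r + 1)).
  by rewrite powRr0 => p1; rewrite ler_peMr// ltW.
exact: ler_powR.
Unshelve. all: by end_near.
Qed.

Theorem lemma1 (R : realType) (d : nat) (hd : (2 <= d)%N)
  (Y : @harmonic_family R d.-1) (hY : orthonormal_harmonics Y)
  (s r Q : R) (hs : 1 / 2 < s) (hr : 1 / 2 <= r) (hQ : 0 < Q)
  (a : nat -> R) (ha : forall k, 0 < a k <= 1)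
  (ha_lim : exists2 L : R, 0 < L &
     a k * (dimf (@Pi R d.-1 k))%:R `^ (2 * s) @[k --> \oo] --> L)
  (dI dO : measure_display) (In : measurableType dI) (Out : measurableType dO)
  (rho : (sphere R d.-1 -> R) -> probability (In * Out)%type R)
  (l : nat -> nat) (hl : forall n, (0 < l n)%N)
  (hlo : (fun n => (l n)%:R : R^o) =o_\oo
         (fun n => n%:R `^ (1 / (2 * s * (2 * r + 1))) : R^o)) :
  ereal_inf
    [set ereal_sup
       [set risk (rho f) (n%:R `^ (2 * r / (2 * r + 1))) G f
         | f in HK_ball Y a Q `&` Sobolev Y a r]
      | G in @sized_estimators R d.-1 _ (In * Out)%type (HK_ball Y a Q) n (l n)]
    @[n --> \oo] --> +oo%E.
Proof.
have s0 : 0 < s by lra.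
have m0 : (0 < d.-1)%N by rewrite -ltnS prednK// ltnW.
have [c c0 Hc] := minimax_lower_bound m0 hY s0 hQ ha ha_lim r.
apply/cvgeyPge => A.
apply: filterS (rate_cvg_pinfty s0 hr c0 hl hlo A) => n An.
(* The target depends on G but the constant c does not, so the bound passes to the infimum. *)
apply: le_ereal_inf_tmp => _ [G GW <-].
have [f fW fG] := Hc _ _ n (l n) (n%:R `^ (2 * r / (2 * r + 1))) G rho
  (hl n) (powR_ge0 _ _) GW.
apply: le_trans (ereal_sup_ubound _); last by exists f.
by apply: le_trans fG; rewrite lee_fin.
Qed.
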